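(* Let $H$ be a finite connected graph (loops allowed, no multiple edges) with at least one edge. The following are equivalent: (i) $H$ is dismantlable. (ii) $H$ is cop-win. (iii) For every finite board $G$, the graph $\hom(G,H)$ is connected. (iv) For every board $G$ and every pair $\varphi,\psi\in\hom(G,H)$ that agree on all but finitely many sites, there is a path in the graph $\hom(G,H)$ between $\varphi$ and $\psi$. (v) There is a positive integer $m$ such that for every board $G$, every pair of sets $U,V$ of sites of $G$ at graph distance at least $m$ from each other, and every pair $\varphi,\psi\in\hom(G,H)$, there is $\theta\in\hom(G,H)$ with $\theta|_U=\varphi|_U$ and $\theta|_V=\psi|_V$. (vi) For every positive integer $r$ and every pair of distinct maps $\varphi,\psi\in\hom(\mathbb{T}^r,H)$, there exist a site $u$ with $\varphi(u)\neq\psi(u)$, a patch $U$ containing $u$, and $\theta\in\hom(\mathbb{T}^r,H)$ which agrees with $\psi$ on $\mathbb{T}^r\setminus U$ and satisfies $\theta(u)=\varphi(u)$. (vii) For every board $G$ and every activity vector $\lambda$, every probability measure on $\hom(G,H)$ satisfying the one-site condition for $\lambda$ is a Gibbs measure for $\lambda$. (viii) For every finite board $G$ and every activity vector $\lambda$, every stationary distribution of the point process $\mathcal{P}(G,H,\lambda)$ is a Gibbs measure for $\lambda$. (ix) For every board $G$ of bounded degree with $\hom(G,H)\neq\emptyset$, there is an activity vector $\lambda$ such that there is a unique Gibbs measure for $\lambda$ on $\hom(G,H)$. (x) For every positive integer $r$, there is an activity vector $\lambda$ such that there is a unique Gibbs measure for $\lambda$ on $\hom(\mathbb{T}^r,H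)$.
   Context: $H$ has node set $\{1,\dots,q\}$; $N(i)$ is the set of nodes adjacent to $i$ (containing $i$ iff $i$ is looped). Fold and dismantlability: if $i\neq j$ are nodes with $N(i)\subseteq N(j)$, the map sending $i$ to $j$ and fixing all other nodes is a homomorphism from $H$ onto the induced subgraph $H\setminus\{i\}$, called a fold; $H$ is dismantlable if some sequence of folds reduces it to a graph with one node. Cop-and-robber game on $H$: the cop first places herself on a node, then the robber places himself on a node (possibly the cop's node); then they alternate moves, cop first, each move being to a node adjacent (in $H$, loops included) to the current node. The cop wins if at some point she moves onto the node occupied by the robber; the robber wins if he avoids this forever. $H$ is cop-win if the cop has a winning strategy. A board $G$ is a countable locally finite loopless graph whose vertices are sites; $\hom(G,H)$ is the set of graph homomorphisms $G\to H$, with the product $\sigma$-algebra, and is made into a graph by declaring $\varphi\sim\psi$ iff they differ at exactly one site. $\mathbb{T}^r$ is the infinite connected cycle-free graph with all degrees $r+1$. An activity vector is $\lambda=(\lambda_1,\dots,\lambda_q)$, all $\lambda_i>0$; for finite $G$ the $\lambda$-measure gives $\varphi$ probability proportional to $\prod_v\lambda_{\varphi(v)}$. A patch is a finite set $U$ of sites, $\partial U$ the set of sites outside $U$ adjacent to $U$, $U^+=U\cup\partial U$. A probability measure $\mu$ on $\hom(G,H)$ is a Gibbs measure for $\lambda$ if for every patch $U$ and $\mu$-a.e. $\psi$, the $\mu$-conditional probability that $\varphi|_U=\psi|_U$ given $\varphi|_{G\setminus U}=\psi|_{G\setminus U}$ equals the $\lambda$-measure (on $\hom(U^+,H)$) conditional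 probability that $\varphi|_U=\psi|_U$ given $\varphi|_{\partial U}=\psi|_{\partial U}$. A measure satisfies the one-site condition for $\lambda$ if this requirement holds for all one-site patches $U=\{u\}$, i.e. a.s. the conditional probability that $\varphi(u)=j$ given $\varphi$ off $u$ is $\lambda_j/\sum_k\lambda_k$, the sum over nodes $k$ adjacent to all $\varphi(v)$, $v\sim u$, if $j$ is such a node, and $0$ otherwise. The point process $\mathcal{P}(G,H,\lambda)$ for finite $G$ is the Markov chain on $\hom(G,H)$ which at each step picks a site $u$ uniformly at random and resamples $\varphi(u)$, choosing each node $j$ adjacent to all $\varphi(v)$, $v\sim u$, with probability proportional to $\lambda_j$. *)

(* Defs.v *)
From HB Require Import structures.
From mathcomp Require Import all_boot all_order all_algebra.
From mathcomp Require Import all_classical all_reals all_analysis.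

Set Implicit Arguments.
Unset Strict Implicit.
Unset Printing Implicit Defensive.

Import Order.TTheory GRing.Theory Num.Theory.
Local Open Scope classical_set_scope.
Local Open Scope ring_scope.

(* Target graph H.  Its nodes are 'I_n.+1 (i.e. q = n+1 >= 1 nodes; H  *)
(* has an edge, so it is nonempty).  Adjacency h : rel 'I_n.+1 is      *)
(* assumed symmetric; h i i means that i is looped.                    *)

Definition nbhd (n : nat) (h : rel 'I_n.+1) (S : {set 'I_n.+1}) (i : 'I_n.+1)
  : {set 'I_n.+1} := [set j in S | h i j].

Inductive dism (n : nat) (h : rel 'I_n.+1) : {set 'I_n.+1} -> Prop :=
| dism_one (S : {set 'I_n.+1}) : #|S| = 1%N -> dism h S
| dism_fold (S : {set 'I_n.+1}) (i j : 'I_n.+1) : i \in S -> j \in S -> i != j ->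
    nbhd h S i \subset nbhd h S j -> dism h (S :\ i) -> dism h S.

Definition dismantlable (n : nat) (h : rel 'I_n.+1) : Prop := dism h [set: 'I_n.+1].

(* Cop and robber.  A cop strategy is an initial node c0 and a map sigma
   sending the sequence of robber positions seen so far [r 0; ..; r k]
   to the cop's next node.  A robber play is any walk r : nat -> node
   (r 0 = initial placement, r k.+1 = robber position after his k-th move).
   cop_pos gives the cop positions: c 0 = c0, c k.+1 = her node after her
   (k+1)-th move, made when the robber stands on r k. *)
Definition cop_pos (n : nat) (c0 : 'I_n.+1) (sigma : seq 'I_n.+1 -> 'I_n.+1)
  (r : nat -> 'I_n.+1) (k : nat) : 'I_n.+1 :=
  match k with 0 => c0 | k'.+1 => sigma (mkseq r k'.+1) end.

Definition cop_win (n : nat) (h : rel 'I_n.+1) : Prop :=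
  exists (c0 : 'I_n.+1) (sigma : seq 'I_n.+1 -> 'I_n.+1),
    forall r : nat -> 'I_n.+1, (forall k, h (r k) (r k.+1)) ->
      (forall k, h (cop_pos c0 sigma r k) (cop_pos c0 sigma r k.+1)) /\
      exists k, cop_pos c0 sigma r k.+1 = r k.

(* Boards: a countable locally finite loopless graph, given by its      *)
(* (finite) neighbour lists nb v.                                       *)
Definition board (V : countType) (nb : V -> seq V) : Prop :=
  (forall u v, (v \in nb u) = (u \in nb v)) /\ (forall u, u \notin nb u).

Definition is_hom (V : countType) (nb : V -> seq V) (n : nat) (h : rel 'I_n.+1)
  (f : V -> 'I_n.+1) : Prop := forall u v, v \in nb u -> h (f u) (f v).

Definition hom_adj (V : Type) (n : nat) (f g : V -> 'I_n.+1) : Prop :=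
  exists u, f u <> g u /\ forall v, v <> u -> f v = g v.

Inductive hom_path (V : countType) (nb : V -> seq V) (n : nat) (h : rel 'I_n.+1)
  : (V -> 'I_n.+1) -> (V -> 'I_n.+1) -> Prop :=
| hom_path_refl f : is_hom nb h f -> hom_path nb h f f
| hom_path_step f g k : hom_path nb h f g -> is_hom nb h k -> hom_adj g k ->
    hom_path nb h f k.

Fixpoint dist_le (V : countType) (nb : V -> seq V) (k : nat) (u v : V) : Prop :=
  match k with
  | 0 => u = v
  | k'.+1 => dist_le nb k' u v \/ exists w, dist_le nb k' u w /\ v \in nb w
  end.

(* The (r+1)-regular tree T^r: reduced words over r+1 letters (Cayley  *)
(* graph of the free product of r+1 copies of Z/2); neighbours of s are *)
(* its parent (s minus its last letter) and its children (s extended by *)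
(* one letter different from its last letter).                         *)
Definition tword (r : nat) := {s : seq 'I_r.+1 | sorted (fun a b => a != b) s}.

Definition tcands (r : nat) (s : seq 'I_r.+1) : seq (seq 'I_r.+1) :=
  take (size s).-1 s :: [seq rcons s a | a <- enum 'I_r.+1].

Definition tnb (r : nat) (s : tword r) : seq (tword r) :=
  [seq t <- pmap (insub : seq 'I_r.+1 -> option (tword r)) (tcands (val s)) | t != s].

(* Measures on hom(G,H): probability measures on the product space      *)
(* V -> nodes with the product sigma-algebra (generated by cylinders),   *)
(* giving full mass to hom(G,H).                                         *)
Definition conf (V : Type) (n : nat) := V -> 'I_n.+1.
HB.instance Definition _ V n := gen_eqMixin (conf V n).
HB.instance Definition _ V n := gen_choiceMixin (conf V n).
HB.instance Definition _ V n := isPointed.Build (conf V n) (fun=> ord0).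

Definition cyl (V : Type) (n : nat) : set (set (conf V n)) :=
  [set A | exists (v : V) (i : 'I_n.+1), A = [set f | f v = i]].

Definition Omega (V : Type) (n : nat) := g_sigma_algebraType (@cyl V n).

Definition homset (V : countType) (nb : V -> seq V) (n : nat) (h : rel 'I_n.+1)
  : set (Omega V n) := [set f | is_hom nb h f].

Definition cyl_out (V : countType) (n : nat) (U : seq V) : set (set (conf V n)) :=
  [set A | exists (v : V) (i : 'I_n.+1), v \notin U /\ A = [set f | f v = i]].

Definition bdry (V : countType) (nb : V -> seq V) (U : seq V) : seq V :=
  [seq v <- flatten (map nb U) | v \notin U].

Definition uplus (V : countType) (nb : V -> seq V) (U : seq V) : seq V :=
  undup (U ++ bdry nb U).

(* The lambda-measure (on hom(U^+,H)) conditional probability that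
   phi|_U = psi|_U given phi|_{dU} = psi|_{dU}. *)
Definition spec (R : realType) (V : countType) (nb : V -> seq V) (n : nat)
  (h : rel 'I_n.+1) (lam : 'I_n.+1 -> R) (U : seq V) (psi : V -> 'I_n.+1) : R :=
  let W := uplus nb U in
  let homW (f : {ffun seq_sub W -> 'I_n.+1}) :=
    [forall x, forall y, (ssval y \in nb (ssval x)) ==> h (f x) (f y)] in
  let wt (f : {ffun seq_sub W -> 'I_n.+1}) := \prod_(x : seq_sub W) lam (f x) in
  let onB (f : {ffun seq_sub W -> 'I_n.+1}) :=
    [forall x, (ssval x \in bdry nb U) ==> (f x == psi (ssval x))] in
  let onU (f : {ffun seq_sub W -> 'I_n.+1}) :=
    [forall x, (ssval x \in U) ==> (f x == psi (ssval x))] in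
  (\sum_(f | homW f && onB f && onU f) wt f) / (\sum_(f | homW f && onB f) wt f).

(* The Gibbs requirement for the patch U: for every configuration eta on U,
   the function phi |-> spec(eta on U, phi on dU) is a version of the
   conditional probability of {phi|_U = eta|_U} given the sigma-algebra
   of the sites outside U (defining property of conditional probability). *)
Definition gibbs_patch (R : realType) (V : countType) (nb : V -> seq V) (n : nat)
  (h : rel 'I_n.+1) (lam : 'I_n.+1 -> R) (P : probability (Omega V n) R)
  (U : seq V) : Prop :=
  forall (eta : V -> 'I_n.+1) (A : set (Omega V n)), <<s @cyl_out V n U >> A ->
    P (A `&` [set f | forall v, v \in U -> f v = eta v]) =
    (\int[P]_(f in A) (spec nb h lam U (fun v => if v \in U then eta v else f v))%:E)%E.

Definition gibbs (R : realType) (V : countType) (nb : V -> seq V) (n : nat)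
  (h : rel 'I_n.+1) (lam : 'I_n.+1 -> R) (P : probability (Omega V n) R) : Prop :=
  P (homset nb h) = 1%E /\ forall U : seq V, gibbs_patch nb h lam P U.

Definition one_site (R : realType) (V : countType) (nb : V -> seq V) (n : nat)
  (h : rel 'I_n.+1) (lam : 'I_n.+1 -> R) (P : probability (Omega V n) R) : Prop :=
  forall u : V, gibbs_patch nb h lam P [:: u].

Definition activity (R : realType) (n : nat) (lam : 'I_n.+1 -> R) : Prop :=
  forall i, 0 < lam i.

Definition unique_gibbs (R : realType) (V : countType) (nb : V -> seq V) (n : nat)
  (h : rel 'I_n.+1) (lam : 'I_n.+1 -> R) : Prop :=
  exists P : probability (Omega V n) R, gibbs nb h lam P /\
    forall Q : probability (Omega V n) R, gibbs nb h lam Q ->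
      forall A : set (Omega V n), measurable A -> Q A = P A.

Definition allowed (V : countType) (nb : V -> seq V) (n : nat) (h : rel 'I_n.+1)
  (f : V -> 'I_n.+1) (u : V) (j : 'I_n.+1) : bool := all (fun v => h (f v) j) (nb u).

Definition pp_kernel (R : realType) (V : finType) (nb : V -> seq V) (n : nat)
  (h : rel 'I_n.+1) (lam : 'I_n.+1 -> R) (f g : V -> 'I_n.+1) : R :=
  \sum_(u : V) #|V|%:R^-1 *
    (if [forall v, (v != u) ==> (f v == g v)] && allowed nb h f u (g u)
     then lam (g u) / \sum_(k | allowed nb h f u k) lam k else 0).

Definition stationary (R : realType) (V : finType) (nb : V -> seq V) (n : nat)
  (h : rel 'I_n.+1) (lam : 'I_n.+1 -> R) (P : probability (Omega V n) R) : Prop :=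
  P (homset nb h) = 1%E /\
  forall g : {ffun V -> 'I_n.+1}, is_hom nb h g ->
    P [set (fun v => g v)] =
    (\sum_(f : {ffun V -> 'I_n.+1})
        P [set (fun v => f v)] * (pp_kernel nb h lam f g)%:E)%E.

(* Main.v *)
Require Import Defs.
From HB Require Import structures.
From mathcomp Require Import all_boot all_order all_algebra.
From mathcomp Require Import all_classical all_reals all_analysis.
From mathcomp Require Import measurable_realfun zify ring lra.
Import Order.TTheory GRing.Theory Num.Theory numFieldNormedType.Exports.

(** Folding the nodes of a dismantlable H one after the other gives maps
    rho_0 = id, rho_1, ..., rho_N = const x0 with rho_s(a) ~ rho_t(b) whenever
    a ~ b and |s - t| <= 1. So a hom may be retracted by rho_(l v) at the site v
    for any 1-Lipschitz l: raising l site by site gives paths in hom(G, H),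
    l = dist(., U) gives mixing, and the cop wins by chasing rho_(N-k) of the
    robber. If H is not dismantlable, it retracts onto a stiff core with two
    nodes, on which the robber escapes and where a hom that sees every
    neighbouring colour around every site is frozen.

    One-site and finite-patch Gibbs conditions both amount to a detailed balance
    between cylinder probabilities, which travels along paths of one-site moves.
    Gibbs measures exist as ultrafilter limits of finite-volume measures. They
    are unique when activities grow fast with the folding order: retracting
    around a set of sites off x0 gains a large weight (a Peierls estimate), and
    exchanging two configurations on the clusters where they are not both equal
    to x0 shows that the boundary condition is forgotten. *)

Set Implicit Arguments.
Unset Strict Implicit.
Unset Printing Implicit Defensive.

(** * Dismantlability *)

(** The tolerance |s - t| <= 1 is what one fold provides: if N(i) lies in N(j), one end of an edge
    may move from i to j while the other end stays. Every use of the maps thereby reduces to the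
    choice of a level function, and the range N of the levels becomes the radius of the balls below.
    In the converse direction the core admits no further fold, so a node is determined by its core
    neighbours; both the tree and the finite double cover are built to carry a colouring that shows
    all of them around each site, which resists local changes up to retraction. On the measure side
    the obstacle is that an ultrafilter limit is only finitely additive, so it is compared with a
    probability only on events about finitely many sites. In the uniqueness estimate, the fibres of
    the retraction and the choice of a path cost a factor per site that depends on n, N and the
    degree but not on the activities; a large base for the activities beats it. *)

Section Dismantling.
Context {n : nat} {h : rel 'I_n.+1}.
Local Open Scope nat_scope.

(** [rk] orders the nodes by the time at which they are folded: a node that moves reaches a strictly
    higher rank. The activities of the uniqueness proof are built on it. [S] is kept general for the
    induction along [dism]. *)
Definition collapse_on (S : {set 'I_n.+1}) (N : nat)
    (rho : nat -> 'I_n.+1 -> 'I_n.+1) (x0 : 'I_n.+1) (rk : 'I_n.+1 -> nat) :=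
  [/\ {in S, rho 0 =1 id},
      (forall s a, a \in S -> rho s a \in S),
      (forall s a, a \in S -> N <= s -> rho s a = x0),
      (forall s t a b, a \in S -> b \in S -> s <= t.+1 -> t <= s.+1 ->
         h a b -> h (rho s a) (rho t b))
    & (forall s a, a \in S -> rho s a = a \/ rk a < rk (rho s a))].

Lemma dism_collapse (S : {set 'I_n.+1}) : symmetric h -> dism h S ->
  exists N rho x0 rk, collapse_on S N rho x0 rk.
Proof.
move=> hs; elim=> [{}S /eqP/cards1P [x ->]|{}S i j iS jS ij sub _ [N [rho [x0 [rk]]]]].
  exists 0, (fun _ => id), x, (fun=> 0); split => //.
  - by move=> s a /set1P ->.
  - by move=> s a _; left.
move=> [r0 rS rN rh rrk].
pose fd a := if a == i then j else a.
have fdS a : a \in S -> fd a \in S :\ i.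
  rewrite /fd !inE; case: (eqVneq a i) => [_|ai] aS; first by rewrite jS eq_sym ij.
  by rewrite ai aS.
(* Folding only one end of an edge leaves an edge: this is what links levels 0 and 1. *)
have fdl a b : a \in S -> b \in S -> h a b -> h a (fd b).
  rewrite /fd; case: eqP => // -> aS _; rewrite hs => hia.
  by move/fintype.subsetP: sub => /(_ a); rewrite !inE aS hia hs; apply.
have fd2 a b : a \in S -> b \in S -> h a b -> h (fd a) (fd b).
  move=> aS bS hab; apply: (fdl) => //; first by have := fdS _ aS; rewrite inE => /andP[].
  by rewrite hs; apply: (fdl) => //; rewrite hs.
(* The new fold comes first, so the old maps are delayed by one level and [i] receives the lowest
   rank. *)
exists N.+1, (fun s a => if s is s'.+1 then rho s' (fd a) else a), x0,
  (fun a => if a == i then 0 else (rk a).+1).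
split.
- by [].
- by move=> [|s] a aS //; have := rS s _ (fdS _ aS); rewrite inE => /andP[].
- by move=> [|s] a aS // Ns; apply: rN => //; apply: fdS.
- move=> [|s] [|t] a b aS bS // st ts hab.
  + have -> : t = 0 by lia.
    by rewrite r0 ?fdS //; apply: (fdl).
  + have -> : s = 0 by lia.
    by rewrite r0 ?fdS // hs; apply: (fdl) => //; rewrite hs.
  + by apply: rh; rewrite ?fdS //; apply: fd2.
- move=> [|s] a aS; first by left.
  have := rS s _ (fdS _ aS); rewrite !inE => /andP[ri _].
  have := rrk s _ (fdS _ aS); rewrite [rho s _ == i](negbTE ri) /fd; case: eqP => ai; first by right.
  by case=> [->|lt]; [left|right].
Qed.

Definition collapse := collapse_on [set: 'I_n.+1].

Lemma dismantlable_collapse : symmetric h -> dismantlable h ->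
  exists N rho x0 rk, collapse N rho x0 rk.
Proof. by move=> hs; apply: dism_collapse. Qed.

Definition stiff (S : {set 'I_n.+1}) := forall i j, i \in S -> j \in S ->
  (forall k, k \in S -> h i k -> h j k) -> i = j.

Definition stiff_retract (S : {set 'I_n.+1}) (rho : 'I_n.+1 -> 'I_n.+1) :=
  [/\ forall a, rho a \in S, {in S, rho =1 id},
      (forall a b, h a b -> h (rho a) (rho b)), stiff S
    & exists s t, [/\ s \in S, t \in S & s != t]].

(** Fold as long as possible, composing the folds into [rho]. Undoing a fold preserves [dism], so no
    set on the way is dismantlable; in particular the last one is not a single node. *)
Lemma stiff_retract_exists : symmetric h -> ~ dismantlable h ->
  exists S rho, stiff_retract S rho.
Proof.
move=> hs; rewrite /dismantlable.
suff H m (S : {set 'I_n.+1}) (rho : 'I_n.+1 -> 'I_n.+1) : #|S| <= m -> ~ dism h S ->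
    (forall a, rho a \in S) -> {in S, rho =1 id} ->
    (forall a b, h a b -> h (rho a) (rho b)) ->
    exists S rho, stiff_retract S rho.
  by move=> nd; apply: (H _ [set: _] id (leqnn _) nd) => // a; rewrite inE.
elim: m S rho => [|m IH] S rho Sm nd rS rid rh.
  by have := rS ord0; rewrite (cards0_eq (_ : #|S| = 0)) ?inE //; lia.
have [st|nst] := pselect (stiff S).
  exists S, rho; split => //; apply: contrapT => ne; apply: nd; apply: dism_one.
  apply/eqP/cards1P; exists (rho ord0); apply/setP => a; rewrite inE.
  apply/idP/eqP => [aS|->//]; apply/eqP; apply/negP => /negP an; apply: ne.
  by exists a, (rho ord0).
have [i [j [iS jS ij sub]]] : exists i j, [/\ i \in S, j \in S, i != j &
    forall k, k \in S -> h i k -> h j k].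
  apply: contrapT => ne; apply: nst => i j iS jS sub; apply/eqP/negP => /negP ij.
  by apply: ne; exists i, j.
pose fd a := if a == i then j else a.
have fdl a b : a \in S -> b \in S -> h a b -> h a (fd b).
  by rewrite /fd; case: eqP => // -> aS _; rewrite hs => /sub; rewrite hs; apply.
apply: (IH (S :\ i) (fd \o rho)).
- by move: Sm; rewrite (cardsD1 i) iS.
- move=> d; apply: nd; apply: (dism_fold iS jS ij) d; apply/fintype.subsetP => k.
  by rewrite !inE => /andP[kS /sub ->]; rewrite ?kS.
- move=> a; rewrite /= /fd !inE; case: (eqVneq (rho a) i) => [_|ai]; first by rewrite jS eq_sym ij.
  by rewrite ai rS.
- by move=> a; rewrite /= !inE => /andP[ai aS]; rewrite rid // /fd (negbTE ai).
- move=> a b /rh hab /=.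
  have fS : fd (rho a) \in S by rewrite /fd; case: ifP.
  by apply: (fdl) => //; rewrite hs; apply: (fdl) => //; rewrite hs.
Qed.

Lemma nbr_exists : symmetric h -> (forall x y, connect h x y) -> (exists x y, h x y) ->
  forall a, exists b, h a b.
Proof.
move=> hs hc [x [y hxy]] a.
have /connectP [[|b p]] := hc a x; last by move=> /= /andP[hab _] _; exists b.
by move=> _ /= <-; exists y.
Qed.

Lemma collapse_cop_win : symmetric h -> (forall a, exists b, h a b) ->
  forall N rho x0 rk, collapse N rho x0 rk -> cop_win h.
Proof.
move=> hs nbr N rho x0 rk [r0 _ rN rh _].
have cN : N.+1 >= N by [].
(* After k+1 observed robber positions the cop goes to level [N - k] of the last one; at k = N the
   level is 0 and she stands on the robber. *)
exists x0, (fun s => rho (N.+1 - size s) (last x0 s)) => r rw.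
have posS k : cop_pos x0 (fun s => rho (N.+1 - size s) (last x0 s)) r k.+1 =
    rho (N - k) (r k).
  by rewrite /cop_pos size_mkseq subSS -[X in last _ X]/(mkseq r k.+1) -nth_last
    size_mkseq nth_mkseq.
split; last by exists N; rewrite posS subnn r0.
move=> [|k]; rewrite posS.
  (* Her first move is legal because [x0] is the level-[N] image of a neighbour of the robber. *)
  rewrite subn0 /=; have [b hb] := nbr (r 0).
  by rewrite -(rN N b) // hs; apply: rh => //; rewrite inE.
by rewrite posS; apply: rh; rewrite ?inE //; lia.
Qed.

(** The robber stays in the core and plays against the shadow [rho] of the cop, always leaving its
    neighbourhood. The shadow moves along edges, so it misses him at the next move, and so does the
    cop, because [rho] fixes his node. *)
Lemma cop_win_dismantlable : symmetric h -> (forall a, exists b, h a b) ->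
  cop_win h -> dismantlable h.
Proof.
move=> hs nbr [c0 [sigma win]]; apply: contrapT => nd.
have [S [rho [rS rid rh st [s [t [sS tS st_neq]]]]]] := stiff_retract_exists hs nd.
have evade a b : a \in S -> a != rho b -> exists c, [/\ c \in S, h a c & ~~ h (rho b) c].
  move=> aS ab; apply: contrapT => ne; case/eqP: ab; apply: st => // k kS hak.
  by apply/negP => /negP nk; apply: ne; exists k.
have evade0 : exists c, [/\ c \in S & ~~ h (rho c0) c].
  have [a [aS ac]] : exists a, a \in S /\ a != rho c0.
    have [se|?] := eqVneq s (rho c0); last by exists s.
    by exists t; split => //; rewrite -se eq_sym.
  by have [c [cS _ nc]] := evade _ _ aS ac; exists c.
have /choice [nx nxP] : forall ab : 'I_n.+1 * 'I_n.+1, exists c, h ab.1 c /\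
    (ab.1 \in S -> ab.1 != rho ab.2 -> c \in S /\ ~~ h (rho ab.2) c).
  move=> [a b] /=; have [[aS ab]|H] := pselect (a \in S /\ a != rho b).
    by have [c []] := evade _ _ aS ab; exists c.
  by have [c hc] := nbr a; exists c; split => // aS ab; case: H.
have [d0 [d0S nd0]] := evade0.
pose hist := fix hist k := if k is k'.+1
  then rcons (hist k') (nx (last d0 (hist k'), sigma (hist k'))) else [:: d0].
pose r k := last d0 (hist k).
have rS1' k : r k.+1 = nx (r k, sigma (hist k)) by rewrite {1}/r /= last_rcons.
have histE k : hist k = mkseq r k.+1.
  by elim: k => [|k IH] //; rewrite mkseqS -IH rS1'.
have {rS1'} rS1 k : r k.+1 = nx (r k, cop_pos c0 sigma r k.+1) by rewrite rS1' histE.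
have [leg [k]] := win r (fun k => ltac:(rewrite rS1; apply: (nxP (_, _)).1)).
have inv m : r m \in S /\ ~~ h (rho (cop_pos c0 sigma r m)) (r m).
  elim: m => [//|m [rmS nrm]]; rewrite rS1.
  apply: (nxP (_, _)).2 => //=; apply: contra nrm => /eqP ->; exact/rh/leg.
have [_] := inv k => /negP nk ck; apply: nk.
by have [kS _] := inv k; have := rh _ _ (leg k); rewrite ck (rid _ kS).
Qed.

End Dismantling.

(** * Homomorphisms of boards *)

Section Levels.
Context {n : nat} {h : rel 'I_n.+1} (V : countType) (nb : V -> seq V).
Hypothesis bnb : board nb.
Local Open Scope nat_scope.

Definition lip (l : V -> nat) := forall u v, v \in nb u -> l u <= (l v).+1.

Definition shift (rho : nat -> 'I_n.+1 -> 'I_n.+1) (l : V -> nat) (f : V -> 'I_n.+1) :=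
  fun v => rho (l v) (f v).

Lemma shift_hom N rho x0 rk (l : V -> nat) f : collapse (h := h) N rho x0 rk ->
  lip l -> is_hom nb h f -> is_hom nb h (shift rho l f).
Proof.
move=> [_ _ _ rh _] ll fh u v vu; apply: rh; rewrite ?inE //; first exact: ll.
  by apply: ll; rewrite -bnb.1.
exact: fh.
Qed.

Lemma seq_max (s : seq V) (l : V -> nat) : s != [::] ->
  exists2 v, v \in s & forall w, w \in s -> l w <= l v.
Proof.
elim: s => [//|a [|b s] IH] _; first by exists a; rewrite ?inE // => w /[!inE] /eqP ->.
have [//|v vs vm] := IH; case: (leqP (l a) (l v)) => av.
  by exists v; [rewrite inE vs orbT|move=> w /[1!inE] /predU1P[->//|]; exact: vm].
exists a => [|w /[1!inE] /predU1P[->//|ws]]; first by rewrite inE eqxx.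
exact: leq_trans (vm _ ws) (ltnW av).
Qed.

(* Lowering a maximal level by one keeps the level function Lipschitz, so the
   shift can be undone one site at a time. *)
Lemma shift_moves N rho x0 rk (E : (V -> 'I_n.+1) -> (V -> 'I_n.+1) -> Prop) (s : seq V)
    (l : V -> nat) f : collapse (h := h) N rho x0 rk ->
  (forall f, E f f) -> (forall f g k, E f g -> E g k -> E f k) ->
  (forall u f g, u \in s -> is_hom nb h f -> is_hom nb h g ->
     (forall v, v != u -> f v = g v) -> E f g) ->
  lip l -> (forall v, v \notin s -> l v = 0) -> is_hom nb h f -> E f (shift rho l f).
Proof.
move=> ctr Er Et Em + + fh.
move: {2}(\sum_(v <- undup s) l v) (leqnn (\sum_(v <- undup s) l v)) => m.
elim: m l => [|m IH] l lm ll ls.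
- have l0 v : l v = 0.
    have [vs|/ls//] := boolP (v \in s).
    by move: lm; rewrite leqn0 sum_nat_seq_eq0 => /allP/(_ v); rewrite mem_undup => /(_ vs)/eqP.
  have -> : shift rho l f = f by apply/funext => v; rewrite /shift l0; case: ctr => -> //; rewrite inE.
  exact: Er.
- have [s0|sN0] := eqVneq s [::].
    have -> : shift rho l f = f.
      by apply/funext => v; rewrite /shift ls ?s0 //; case: ctr => -> //; rewrite inE.
    exact: Er.
  have [v vs vm] := seq_max l sN0.
  have vm' w : l w <= l v by have [/vm//|/ls->] := boolP (w \in s).
  have [lv0|lv0] := posnP (l v).
    have -> : shift rho l f = f.
      apply/funext => w; rewrite /shift; have -> : l w = 0 by have := vm' w; lia.
      by case: ctr => -> //; rewrite inE.
    exact: Er.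
  pose l' w := if w == v then (l v).-1 else l w.
  have ll' : lip l'.
    move=> u w wu; have := ll u w wu; have := vm' w; have := vm' u.
    by rewrite /l'; do 2?case: eqP => [->|_]; lia.
  have ls' w : w \notin s -> l' w = 0.
    by move=> ws; rewrite /l'; case: eqP => [wv|_]; [move: ws; rewrite wv vs|exact: ls].
  apply: Et (IH l' _ ll' ls') _.
    move: lm; rewrite !(bigD1_seq v) ?undup_uniq ?mem_undup //= {1}/l' eqxx.
    rewrite [X in _ -> _ + X <= _](eq_bigr l) => [|w /negbTE wv]; last by rewrite /l' wv.
    lia.
  apply: (Em v) => //; try by apply: (shift_hom ctr).
  by move=> w /negbTE wv; rewrite /shift /l' wv.
Qed.

(** When [b k] is the ball of radius k around a set, this is N minus the distance to that set, cut
    off at 0. *)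
Definition lev (b : nat -> V -> bool) N v := \sum_(k < N) b k v.

Lemma lev_lip (b : nat -> V -> bool) N :
  (forall k u v, v \in nb u -> b k u -> b k.+1 v) -> lip (lev b N).
Proof.
move=> bS u v vu; rewrite /lev; case: N => [|N]; first by rewrite !big_ord0.
rewrite big_ord_recr [X in _ <= X.+1]big_ord_recl /=.
(* Term i at [u] is paired with term i+1 at [v]; only the last term at [u] is left over, and it is
   at most 1. *)
suff : \sum_(i < N) b i u <= \sum_(i < N) b (bump 0 i) v.
  by move=> H; apply: leq_trans (leq_add H (leq_b1 _)) _; rewrite addn1 ltnS leq_addl.
by apply: leq_sum => i _; have := bS i _ _ vu; case: (b i u) => // ->.
Qed.

Fixpoint ball (s : seq V) k := if k is k'.+1
  then ball s k' ++ flatten (map nb (ball s k')) else s.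

Lemma ball_leq s k k' v : k <= k' -> v \in ball s k -> v \in ball s k'.
Proof.
move=> /subnK <-; elim: (k' - k) => //= m IH /IH H.
by rewrite mem_cat H.
Qed.

Lemma ball_step s k u v : v \in nb u -> u \in ball s k -> v \in ball s k.+1.
Proof.
by move=> vu us; rewrite /= mem_cat; apply/orP; right; apply/flatten_mapP; exists u.
Qed.

Definition blev s N := lev (fun k v => v \in ball s k) N.

Lemma blev_lip s N : lip (blev s N).
Proof. by apply: lev_lip => k u v; apply: ball_step. Qed.

Lemma blev_in s N v : v \in s -> blev s N v = N.
Proof.
move=> vs; rewrite /blev /lev (eq_bigr (fun=> 1)) ?sum1_card ?card_ord // => k _.
by rewrite (ball_leq (k := 0)).
Qed.

Lemma blev_out s N v : v \notin ball s N -> blev s N v = 0.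
Proof.
move=> vs; rewrite /blev /lev big1 // => k _.
by case: (boolP (_ \in _)) => // /(ball_leq (ltnW (ltn_ord k))) H; rewrite H in vs.
Qed.

Lemma shift_agree N rho x0 rk (s : seq V) l (f g : V -> 'I_n.+1) : collapse (h := h) N rho x0 rk ->
  (forall v, v \notin s -> f v = g v) -> (forall v, v \in s -> l v = N) ->
  shift rho l f = shift rho l g.
Proof.
move=> [_ _ rN _ _] fg ls; apply/funext => v; rewrite /shift.
by have [vs|/fg->//] := boolP (v \in s); rewrite !rN ?inE // ls.
Qed.

(** Raising the level to [N] on [s] turns every site of [s] into [x0], so the retractions of [f] and
    [g] coincide and both can be joined to it. [E] is abstract because the argument serves paths of
    homs as well as detailed balance. *)
Lemma agree_moves N rho x0 rk (E : (V -> 'I_n.+1) -> (V -> 'I_n.+1) -> Prop) s f g :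
  collapse (h := h) N rho x0 rk ->
  (forall f, E f f) -> (forall f g k, E f g -> E g k -> E f k) ->
  (forall u f g, u \in ball s N -> is_hom nb h f -> is_hom nb h g ->
     (forall v, v != u -> f v = g v) -> E f g) ->
  is_hom nb h f -> is_hom nb h g -> (forall v, v \notin s -> f v = g v) -> E f g.
Proof.
move=> ctr Er Et Em fh gh fg.
(* [shift_moves] leads from a map to its retraction; the symmetrized relation lets the second half
   be run backwards. *)
pose E' f g := E f g /\ E g f.
have [||||||H _] := @shift_moves N rho x0 rk E' (ball s N) (blev s N) f ctr => //.
- by move=> k1 k2 k3 [? ?] [? ?]; split; apply: Et; eauto.
- move=> u k1 k2 us h1 h2 k12; split; first exact: (Em u).
  by apply: (Em u) => // v /k12.
- exact: blev_lip.
- by move=> v; apply: blev_out.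
have [||||||_ H'] := @shift_moves N rho x0 rk E' (ball s N) (blev s N) g ctr => //.
- by move=> k1 k2 k3 [? ?] [? ?]; split; apply: Et; eauto.
- move=> u k1 k2 us h1 h2 k12; split; first exact: (Em u).
  by apply: (Em u) => // v /k12.
- exact: blev_lip.
- by move=> v; apply: blev_out.
apply: Et H _; rewrite (shift_agree (s := s) (g := g) ctr) // => v; exact: blev_in.
Qed.

Lemma hom_path_hom f g : hom_path nb h f g -> is_hom nb h f /\ is_hom nb h g.
Proof. by elim=> // k1 k2 k3 _ [? _]. Qed.

Lemma hom_path_trans f g k : hom_path nb h f g -> hom_path nb h g k -> hom_path nb h f k.
Proof.
move=> + gk; elim: gk => // k1 k2 k3 _ IH h3 adj /IH H.
exact: hom_path_step H h3 adj.
Qed.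

Lemma collapse_paths N rho x0 rk f g : collapse (h := h) N rho x0 rk ->
  is_hom nb h f -> is_hom nb h g ->
  (exists s : seq V, forall v, v \notin s -> f v = g v) -> hom_path nb h f g.
Proof.
move=> ctr fh gh [s fg].
pose E k1 k2 := is_hom nb h k1 -> hom_path nb h k1 k2.
apply: (agree_moves (E := E) ctr _ _ _ fh gh fg fh).
- by move=> k hk; apply: hom_path_refl.
- by move=> k1 k2 k3 h1 h2 hk; apply: hom_path_trans (h1 hk) (h2 (hom_path_hom (h1 hk)).2).
move=> u k1 k2 _ h1 h2 k12 _.
have [e|ne] := eqVneq (k1 u) (k2 u).
  have -> : k2 = k1; last exact: hom_path_refl.
  by apply/funext => v; have [->|/k12] := eqVneq v u.
apply: hom_path_step (hom_path_refl h1) h2 _.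
by exists u; split; [apply/eqP|move=> v /eqP/k12].
Qed.

Lemma dist_le_leq k k' u v : k <= k' -> dist_le nb k u v -> dist_le nb k' u v.
Proof. by move=> /subnK <-; elim: (k' - k) => //= m IH /IH H; left. Qed.

Lemma dist_le_trans a b u v w : dist_le nb a u v -> dist_le nb b v w ->
  dist_le nb (a + b) u w.
Proof.
elim: b w => [w uv <-|b IH w uv /=]; first by rewrite addn0.
rewrite addnS; case=> [/(IH _ uv)|[x [/(IH _ uv) H wx]]]; first by left.
by right; exists x.
Qed.

Lemma dist_le_sym k u v : dist_le nb k u v -> dist_le nb k v u.
Proof.
elim: k v => [//|k IH v] /=; case=> [/IH|[w [/IH uw vw]]]; first by left.
rewrite -/(dist_le nb k.+1 v u) -add1n; apply: dist_le_trans uw.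
by right; exists v; split => //; rewrite bnb.1.
Qed.

(** Retract [f] more and more away from [U], and [g] away from [W]. Halfway both have become [x0],
    so they can be glued there. *)
Lemma collapse_mixing N rho x0 rk (U W : V -> Prop) f g :
  collapse (h := h) N rho x0 rk -> symmetric h ->
  (forall u v, U u -> W v -> ~ dist_le nb N.*2 u v) ->
  is_hom nb h f -> is_hom nb h g ->
  exists t : V -> 'I_n.+1, is_hom nb h t /\
    (forall u, U u -> t u = f u) /\ (forall v, W v -> t v = g v).
Proof.
move=> ctr hs UW fh gh.
pose b (X : V -> Prop) k v := `[< exists u, X u /\ dist_le nb k u v >].
have bS X k u v : v \in nb u -> b X k u -> b X k.+1 v.
  move=> vu /asboolP [x [Xx xu]]; apply/asboolP; exists x; split => //.
  by right; exists u.
(* [lev] decreases with the distance; its complement is the distance to [X] capped at [N]. *)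
pose l X v := N - lev (b X) N v.
have ll X : lip (l X).
  move=> u v vu; have := @lev_lip (b X) N (bS X) v u; rewrite bnb.1 => /(_ vu).
  by rewrite /l; lia.
have l0 X v : X v -> l X v = 0.
  move=> Xv; rewrite /l /lev (eq_bigr (fun=> 1)) ?sum1_card ?card_ord ?subnn // => k _.
  suff -> : b X k v by [].
  by apply/asboolP; exists v; split => //; apply: (dist_le_leq (k := 0)).
have lN X v : (forall k, k < N -> ~~ b X k v) -> l X v = N.
  move=> bk; rewrite /l /lev big1 ?subn0 // => k _.
  by rewrite (negbTE (bk k (ltn_ord k))).
pose t v := if b U N v then shift rho (l U) f v else shift rho (l W) g v.
have fh' := shift_hom ctr (ll U) fh.
have gh' := shift_hom ctr (ll W) gh.
have bsep v a c : a + c <= N.*2 -> b U a v -> b W c v -> False.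
  move=> ac /asboolP [u [Uu uv]] /asboolP [w [Ww wv]]; apply: (UW _ _ Uu Ww).
  by apply: dist_le_leq ac _; apply: dist_le_trans uv (dist_le_sym wv).
case: (ctr) => r0 _ rN _ _.
(* An edge leaving the [N]-ball of [U] starts at a site at distance at least [N] from both [U] and
   [W]. Both retractions are [x0] there, so the edge may be read in the retraction of [g]. *)
have tedge u v : v \in nb u -> b U N u -> ~~ b U N v -> h (t u) (t v).
  move=> vu bu bv; rewrite /t bu (negbTE bv).
  have -> : shift rho (l U) f u = shift rho (l W) g u.
    rewrite /shift !lN ?rN ?inE // => k kN; apply/negP => bk.
      by apply: (bsep u N k) => //; lia.
    move/negP: bv; apply; have /asboolP [x [Ux xv]] := bS _ _ _ _ vu bk.
    by apply/asboolP; exists x; split => //; apply: dist_le_leq xv.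
  exact: gh'.
exists t; split; last split.
- move=> u v vu; case: (boolP (b U N u)) => bu; case: (boolP (b U N v)) => bv.
  + by rewrite /t bu bv; apply: fh'.
  + exact: tedge.
  + by rewrite hs; apply: tedge => //; rewrite bnb.1.
  + by rewrite /t (negbTE bu) (negbTE bv); apply: gh'.
- move=> u Uu; rewrite /t; have -> : b U N u.
    by apply/asboolP; exists u; split => //; apply: (dist_le_leq (k := 0)).
  by rewrite /shift l0 // r0 ?inE.
- move=> v Wv; rewrite /t; case: ifPn => [bv|_]; last by rewrite /shift l0 // r0 ?inE.
  case: (bsep v N 0) => //; first by lia.
  by apply/asboolP; exists v.
Qed.

End Levels.

(** * Regular trees and their frozen colourings *)

Section Tree.
Context {n : nat} {h : rel 'I_n.+1}.
Local Open Scope nat_scope.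

Lemma tnbP r (s t : tword r) : reflect
  ((exists a, val t = rcons (val s) a) \/ (exists a, val s = rcons (val t) a)) (t \in tnb s).
Proof.
rewrite /tnb mem_filter mem_pmap.
have -> : (Some t \in [seq (insub : seq 'I_r.+1 -> option (tword r)) i | i <- tcands (val s)])
   = (val t \in tcands (val s)).
  apply/mapP/idP => [[w ws]|ts]; last by exists (val t); rewrite ?valK.
  by case: insubP => // x _ xw [->]; rewrite xw.
rewrite /tcands in_cons; apply: (iffP andP) => [[ts /orP[/eqP e|/mapP[a _ ->]]]|]; [|by left; exists a|].
  right; case/lastP es: (val s) e => [|w a]; last first.
    by rewrite size_rcons -{1}(cats1 w a) take_size_cat // => ->; exists a.
  by move=> e; move: ts; rewrite -(inj_eq val_inj) /= es e eqxx.
case=> [[a e]|[a e]]; split.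
- by apply/eqP => ts; move: (congr1 size e); rewrite ts size_rcons; lia.
- by rewrite e; apply/orP; right; apply/mapP; exists a; rewrite ?mem_enum.
- by apply/eqP => ts; move: (congr1 size e); rewrite ts size_rcons; lia.
- by rewrite e size_rcons -(cats1 _ a) take_size_cat // eqxx.
Qed.

Lemma tree_board r : board (@tnb r).
Proof.
split=> [s t|s]; first by apply/tnbP/tnbP => -[]; tauto.
apply/tnbP => -[] [a /(congr1 size)]; rewrite size_rcons; lia.
Qed.

Lemma tnb_size r (s : tword r) : size (undup (tnb s)) <= r.+2.
Proof.
apply: leq_trans (size_undup _) _; rewrite size_filter.
apply: leq_trans (count_size _ _) _; rewrite size_pmap.
apply: leq_trans (count_size _ _) _.
by rewrite /= !size_map -enumT size_enum_ord.
Qed.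

Lemma tree_hom r : (exists x y, h x y) -> symmetric h -> exists f, is_hom (@tnb r) h f.
Proof.
move=> [x [y hxy]] hs; exists (fun s => if odd (size (val s)) then x else y) => s t.
by move=> /tnbP [] [a ->]; rewrite size_rcons /=; case: (odd _) => //=; rewrite hs.
Qed.

(** [P] restricts the neighbours used as witnesses: the children of a site on the tree, all
    neighbours on the double cover. *)
Definition covering (S : {set 'I_n.+1}) (V : countType) (nb : V -> seq V)
  (f : V -> 'I_n.+1) (u : V) (P : V -> Prop) :=
  forall j, j \in S -> h (f u) j -> exists v, [/\ v \in nb u, P v & f v = j].

(** [rho (f u)] is adjacent to every core neighbour of [phi u], since each of these is the retracted
    colour of a neighbour of [u]; stiffness then identifies the two nodes. *)
Lemma covering_frozen S rho (V : countType) (nb : V -> seq V) (phi f : V -> 'I_n.+1) u P :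
  stiff_retract (h := h) S rho -> is_hom nb h f -> phi u \in S ->
  covering S nb phi u P -> (forall v, v \in nb u -> P v -> rho (f v) = phi v) ->
  rho (f u) = phi u.
Proof.
move=> [rS _ rh st _] fh uS cov fv; apply/esym/st => // k kS /cov.
by move=> /(_ kS) [v [vu Pv <-]]; rewrite -(fv v) //; apply/rh/fh.
Qed.

(** The degree provides two letters for each node of H. A reduced word forbids only its last letter,
    so every colour remains available for some child. *)
Lemma tree_covering S rho i0 : stiff_retract (h := h) S rho ->
  (forall a, exists b, h a b) -> symmetric h -> i0 \in S ->
  exists phi : tword n.*2.+1 -> 'I_n.+1,
  [/\ is_hom (@tnb _) h phi, forall s, phi s \in S,
      phi (exist _ [::] isT) = i0 &
      forall s, covering S (@tnb _) phi s (fun t => size (val t) = (size (val s)).+1)].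
Proof.
move=> [rS rid rh _ _] nbr hs i0S.
have /choice [d dP] : forall i, exists j, i \in S -> j \in S /\ h i j.
  move=> i; have [j hij] := nbr i; exists (rho j) => iS; split => //.
  by rewrite -[i]rid //; apply: rh.
(* A letter proposes its residue as the colour of the child; if that is not a core neighbour, the
   fixed core neighbour [d i] is used. *)
pose step i (a : 'I_n.*2.+2) := let j : 'I_n.+1 := inord (a %% n.+1) in
  if (j \in S) && h i j then j else d i.
have stepP i a : i \in S -> step i a \in S /\ h i (step i a).
  by move=> iS; rewrite /step; case: ifP => [/andP//|_]; apply: dP.
pose phi (s : tword n.*2.+1) := foldl step i0 (val s).
have phiS s : phi s \in S.
  by rewrite /phi; elim/last_ind: (val s) => // w a IH; rewrite foldl_rcons; apply: (stepP _ _ IH).1.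
have phiR s t a : val t = rcons (val s) a -> phi t = step (phi s) a.
  by rewrite /phi => ->; rewrite foldl_rcons.
exists phi; split => //.
- move=> s t /tnbP [] [a e]; rewrite (phiR _ _ _ e); last rewrite hs.
    exact: (stepP _ _ (phiS _)).2.
  exact: (stepP _ _ (phiS _)).2.
move=> s j jS hj.
have [a [am al]] : exists a : 'I_n.*2.+2, a %% n.+1 = j /\
    sorted (fun a b => a != b) (rcons (val s) a).
  have j1 : j < n.*2.+2 by have := ltn_ord j; lia.
  have j2 : j + n.+1 < n.*2.+2 by have := ltn_ord j; lia.
  have srt (a : 'I_n.*2.+2) : a != last a (val s) \/ val s = [::] ->
      sorted (fun a b => a != b) (rcons (val s) a).
    case: (s) => -[|x w] ss //=.
    by rewrite rcons_path (ss : path _ x w) /= eq_sym; case.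
  have [js|js] := eqVneq (Ordinal j1) (last (Ordinal j1) (val s)); last first.
    by exists (Ordinal j1); split; [rewrite modn_small //=; exact: ltn_ord|apply: srt; left].
  exists (Ordinal j2); split; first by rewrite /= modnDr modn_small // ltn_ord.
  apply: srt; case: (val s) js => [|x w] /=; [by right|move=> <-; left].
  by apply/eqP => /(congr1 val) /=; lia.
have e : val (exist _ (rcons (val s) a) al : tword n.*2.+1) = rcons (val s) a by [].
exists (exist _ (rcons (val s) a) al); split.
- by apply/tnbP; left; exists a.
- by rewrite e size_rcons.
by rewrite (phiR _ _ _ e) /step am inord_val jS hj.
Qed.

(** Induction from the depths of the tree towards the root: below the deepest site of [U] the maps
    agree, and the children of a site determine its retracted colour. *)
Lemma tree_frozen S rho r (phi f : tword r -> 'I_n.+1) (U : seq (tword r)) :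
  stiff_retract (h := h) S rho -> is_hom (@tnb r) h f -> (forall s, phi s \in S) ->
  (forall s, covering S (@tnb r) phi s (fun t => size (val t) = (size (val s)).+1)) ->
  (forall v, v \notin U -> f v = phi v) -> forall s, rho (f s) = phi s.
Proof.
move=> st fh pS cov fU s; case: (st) => _ rid _ _ _.
pose m := \max_(u <- U) size (val u).
move: {2}(m.+1 - size (val s)) (leqnn (m.+1 - size (val s))) => k.
elim: k s => [|k IH] s sk.
  rewrite fU ?rid //; apply/negP => sU.
  have sm : size (val s) <= m.
    exact: (@leq_bigmax_seq _ U xpredT (fun u : tword r => size (val u)) s sU isT).
  by move: sk; rewrite leqNgt subn_gt0 ltnS sm.
by apply: (covering_frozen st fh _ (cov s)) => // v _ sv; apply: IH; move: sk; rewrite sv subnS; case: (_ - _).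
Qed.

Lemma mixing_tree_extension m : symmetric h -> 
  (forall (V : countType) (nb : V -> seq V), board nb ->
     forall (U W : V -> Prop), (forall u v, U u -> W v -> ~ dist_le nb m u v) ->
     forall f g : V -> 'I_n.+1, is_hom nb h f -> is_hom nb h g ->
     exists t : V -> 'I_n.+1, is_hom nb h t /\
       (forall u, U u -> t u = f u) /\ (forall v, W v -> t v = g v)) ->
  forall r (f g : tword r -> 'I_n.+1), is_hom (@tnb r) h f -> is_hom (@tnb r) h g ->
     f <> g ->
     exists (u : tword r) (U : seq (tword r)) (t : tword r -> 'I_n.+1),
       f u <> g u /\ u \in U /\ is_hom (@tnb r) h t /\
       (forall v, v \notin U -> t v = g v) /\ t u = f u.
Proof.
move=> hs mix r f g fh gh fg.
have [u fu] : exists u, f u <> g u.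
  by apply: contrapT => H; apply: fg; apply/funext => u; apply: contrapT => Hu; apply: H; exists u.
have inb k v : dist_le (@tnb r) k u v -> v \in ball (@tnb r) [:: u] k.
  elim: k v => [v /= ->|k IH v /=]; first by rewrite inE.
  by case=> [/IH H|[w [/IH H vw]]]; [rewrite mem_cat H|apply: (ball_step vw)].
have [|t [th [tU tW]]] := mix _ _ (tree_board r) (fun v => v = u)
  (fun v => v \notin ball (@tnb r) [:: u] m) _ f g fh gh.
  by move=> _ v -> /negP nv /inb.
exists u, (ball (@tnb r) [:: u] m), t; split => //; split; last by split => //; split => //; apply: tU.
by apply: (ball_leq (k := 0)) => //=; rewrite inE.
Qed.

(** Two covering colourings with different roots violate the extension property: a map equal to the
    second one off a finite set retracts onto it everywhere, whereas at [u] it takes the core colour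
    of the first one. *)
Lemma tree_extension_dismantlable : symmetric h -> (forall a, exists b, h a b) ->
  (forall r : nat, (0 < r)%N ->
     forall f g : tword r -> 'I_n.+1, is_hom (@tnb r) h f -> is_hom (@tnb r) h g ->
     f <> g ->
     exists (u : tword r) (U : seq (tword r)) (t : tword r -> 'I_n.+1),
       f u <> g u /\ u \in U /\ is_hom (@tnb r) h t /\
       (forall v, v \notin U -> t v = g v) /\ t u = f u) -> dismantlable h.
Proof.
move=> hs nbr ext; apply: contrapT => nd.
have [S [rho st]] := stiff_retract_exists hs nd.
case: (st) => _ rid _ _ [a [b [aS bS ab]]].
have [f [fh fS fr _]] := tree_covering st nbr hs aS.
have [g [gh gS gr gc]] := tree_covering st nbr hs bS.
have [|u [U [t [fgu [uU [th [tg tf]]]]]]] := ext n.*2.+1 isT f g fh gh.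
  by move=> fg; move: ab; rewrite -fr fg gr eqxx.
by have := tree_frozen st th gS gc tg u; rewrite tf rid.
Qed.

End Tree.

(** * A finite board with a rigid colouring *)

Section Double.
Context {n : nat} {h : rel 'I_n.+1}.
Variables (S : {set 'I_n.+1}) (rho : 'I_n.+1 -> 'I_n.+1).
Hypotheses (hs : symmetric h) (st : stiff_retract (h := h) S rho).
Local Open Scope nat_scope.

(** The Boolean makes the board bipartite, hence loopless even where a core node is looped. *)
Definition dsite : finType := ('I_n.+1 * bool)%type.

(* Double cover of the stiff core: [(i, a)] stands for a copy of [rho i], so
   that every site has a colour in the core without passing to a subtype. *)
Definition dnb (u : dsite) : seq dsite :=
  [seq (j, ~~ u.2) | j <- enum 'I_n.+1 & h (rho u.1) (rho j)].

Definition dphi (u : dsite) : 'I_n.+1 := rho u.1.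

Lemma dnbP u v : (v \in dnb u) = h (rho u.1) (rho v.1) && (v.2 == ~~ u.2).
Proof.
apply/mapP/andP => [[j]|[hv /eqP ev]].
  by rewrite mem_filter => /andP[hj _] -> /=.
exists v.1; first by rewrite mem_filter hv mem_enum.
by rewrite -ev; case: v {hv ev}.
Qed.

Lemma dnb_board : board dnb.
Proof.
split=> [u v|u]; rewrite !dnbP; last by case: u.2; rewrite andbF.
by rewrite hs; case: u.2; case: v.2.
Qed.

Lemma dphi_hom : is_hom dnb h dphi.
Proof. by move=> u v; rewrite dnbP => /andP[]. Qed.

Lemma dphi_rigid f u : is_hom dnb h f -> (forall v, v != u -> rho (f v) = dphi v) ->
  rho (f u) = dphi u.
Proof.
move=> fh fv; case: (st) => rS rid _ _ _.
apply: (@covering_frozen _ _ S rho _ dnb dphi f u (fun=> True) st fh) => //; first exact: rS.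
  move=> j jS hj; exists (j, ~~ u.2); split => //; last by rewrite /dphi /= (rid _ jS).
  by rewrite dnbP /= (rid _ jS) eqxx andbT.
by move=> v vu _; apply: fv; apply: contraTneq vu => ->; exact: dnb_board.2.
Qed.

(** A colouring of the two sides by the ends of an edge is constant on each side, while [dphi] takes
    the distinct core values [a] and [b] on the side [true]. *)
Lemma dphi_other : (exists x y, h x y) ->
  exists2 psi, is_hom dnb h psi & exists v, rho (psi v) <> dphi v.
Proof.
case: st => _ rid rh _ [a [b [aS bS /eqP ab]]] [x [y hxy]].
exists (fun u => if u.2 then x else y).
  by move=> u v; rewrite dnbP => /andP[_ /eqP ->]; case: u.2 => //=; rewrite hs.
have [xa|] := pselect (rho x = a); last by exists (a, true); rewrite /dphi /= (rid _ aS).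
by exists (b, true); rewrite /dphi /= (rid _ bS) xa.
Qed.

End Double.

(** Retracting onto [dphi] is invariant under one-site moves by [dphi_rigid], so no path joins
    [dphi] to the colouring of [dphi_other]. *)
Lemma connected_homs_dismantlable n (h : rel 'I_n.+1) : symmetric h ->
  (exists x y, h x y) ->
  (forall (V : finType) (nb : V -> seq V), board nb ->
     forall f g : V -> 'I_n.+1, is_hom nb h f -> is_hom nb h g -> hom_path nb h f g) ->
  dismantlable h.
Proof.
move=> hs he conn; apply: contrapT => nd.
have [S [rho st]] := stiff_retract_exists hs nd.
have [psi psih [v]] := dphi_other hs st he; apply.
have inv f g : hom_path (dnb (h := h) rho) h f g -> (forall v, rho (f v) = dphi rho v) ->
    forall v, rho (g v) = dphi rho v.
  elim=> // {}f {}g k _ IH kh [u [_ gk]] r0 w.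
  have fr w' : w' != u -> rho (k w') = dphi rho w' by move=> /eqP wu; rewrite -gk // (IH r0).
  have [->|/fr//] := eqVneq w u.
  exact: (@dphi_rigid _ _ _ _ hs st k u kh fr).
apply: (inv _ _ (conn _ _ (dnb_board rho hs) _ _ (@dphi_hom _ _ rho) psih)).
by case: st => rS rid _ _ _ w; rewrite /dphi rid.
Qed.

Local Open Scope classical_set_scope.
Local Open Scope ring_scope.

(** * Finite-volume weights and specifications *)

Section Glue.
Context (V : countType) (n : nat).
Implicit Types (U : seq V) (f g : V -> 'I_n.+1).

Definition glue U (x : {ffun seq_sub U -> 'I_n.+1}) f : V -> 'I_n.+1 :=
  fun v => if insub v is Some y then x y else f v.

Definition res U f : {ffun seq_sub U -> 'I_n.+1} := [ffun y => f (ssval y)].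

Lemma glue_in U x f (y : seq_sub U) : glue x f (ssval y) = x y.
Proof. by rewrite /glue -[ssval y]/(val y) valK. Qed.

Lemma glue_out U (x : {ffun seq_sub U -> 'I_n.+1}) f v : v \notin U -> glue x f v = f v.
Proof. by move=> vU; rewrite /glue insubN. Qed.

Lemma glue_res U f g v : v \in U -> glue (res U f) g v = f v.
Proof. by move=> vU; rewrite -[v]/(ssval (SeqSub vU)) glue_in ffunE. Qed.

Lemma res_glue U (x : {ffun seq_sub U -> 'I_n.+1}) f : res U (glue x f) = x.
Proof. by apply/ffunP => y; rewrite ffunE glue_in. Qed.

Lemma glue_res_id U f g : (forall v, v \notin U -> f v = g v) -> glue (res U f) g = f.
Proof.
move=> fg; apply/funext => v; have [vU|vU] := boolP (v \in U); first exact: glue_res.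
by rewrite glue_out // fg.
Qed.

Lemma glue_ext U (x : {ffun seq_sub U -> 'I_n.+1}) f g :
  (forall v, v \notin U -> f v = g v) -> glue x f = glue x g.
Proof.
move=> fg; apply/funext => v; have [vU|vU] := boolP (v \in U).
  by rewrite -[v]/(ssval (SeqSub vU)) !glue_in.
by rewrite !glue_out // fg.
Qed.

Lemma resP U f g : reflect (forall v, v \in U -> f v = g v) (res U f == res U g).
Proof.
apply: (iffP eqP) => [e v vU|fg].
  by have /ffunP/(_ (SeqSub vU)) := e; rewrite !ffunE.
by apply/ffunP => y; rewrite !ffunE fg ?ssvalP.
Qed.

End Glue.

Lemma prod_seq_sub (R : comPzRingType) (V : countType) (W : seq V) (F : V -> R) : uniq W ->
  \prod_(y : seq_sub W) F (ssval y) = \prod_(v <- W) F v.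
Proof.
move=> uW; rewrite -[in RHS](val_seq_sub_enum uW) big_map.
apply/perm_big/uniq_perm; rewrite ?index_enum_uniq ?undup_uniq // => y.
by rewrite mem_index_enum mem_seq_sub_enum.
Qed.

Section Weights.
Context {R : realType} {n : nat} {h : rel 'I_n.+1} (V : countType) (nb : V -> seq V)
  (lam : 'I_n.+1 -> R).
Hypotheses (bnb : board nb) (hs : symmetric h) (lam_gt0 : activity lam).
Implicit Types (U B : seq V) (f g : V -> 'I_n.+1).

Definition weight U f := \prod_(v <- undup U) lam (f v).

(** The partition function of [U] with boundary condition [f]. The hom condition concerns the whole
    board; [spec_hom] reconciles this with [spec], which only looks at the patch and its
    boundary. *)
Definition pfun U f := \sum_(x : {ffun seq_sub U -> 'I_n.+1} | `[< is_hom nb h (glue x f) >])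
  weight U (glue x f).

Lemma weight_gt0 U f : 0 < weight U f.
Proof. by apply: prodr_gt0 => v _; apply: lam_gt0. Qed.

Lemma pfun_gt0 U f : is_hom nb h f -> 0 < pfun U f.
Proof.
move=> fh; rewrite /pfun (bigD1 (res U f)) /=; last by rewrite glue_res_id //; apply/asboolP.
by apply: ltr_wpDr; [apply: sumr_ge0 => x _; apply/ltW/weight_gt0|apply: weight_gt0].
Qed.

Lemma weight_ext U f g : (forall v, v \in U -> f v = g v) -> weight U f = weight U g.
Proof.
move=> fg; rewrite /weight [LHS]big_seq [RHS]big_seq; apply: eq_bigr => v.
by rewrite mem_undup => /fg ->.
Qed.

Lemma weight_split U B f : {subset U <= B} ->
  weight B f = weight U f * \prod_(v <- undup B | v \notin U) lam (f v).
Proof.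
move=> UB; rewrite /weight (bigID (mem U)) /=; congr (_ * _).
rewrite -big_filter; apply/perm_big/uniq_perm; rewrite ?filter_uniq ?undup_uniq // => v.
by rewrite mem_filter !mem_undup; case: (boolP (v \in U)) => //= /UB ->.
Qed.

Lemma weight_ratio U B f g : {subset U <= B} -> (forall v, v \notin U -> f v = g v) ->
  weight B f * weight U g = weight B g * weight U f.
Proof.
move=> UB fg; rewrite !(weight_split _ UB).
rewrite (eq_bigr (fun v => lam (g v))) => [|v /fg -> //]; ring.
Qed.

Lemma pfun_ext U f g : (forall v, v \notin U -> f v = g v) -> pfun U f = pfun U g.
Proof.
by move=> fg; rewrite /pfun; apply: eq_big => [x|x _]; rewrite (glue_ext x fg).
Qed.

Lemma mem_uplus U v : (v \in uplus nb U) = (v \in U) || (v \in bdry nb U).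
Proof. by rewrite mem_undup mem_cat. Qed.

Lemma mem_bdry U v : (v \in bdry nb U) = (v \notin U) && (v \in flatten (map nb U)).
Proof. by rewrite mem_filter. Qed.

Lemma uplus_nb U u v : u \in U -> v \in nb u -> v \in uplus nb U.
Proof.
move=> uU vu; rewrite mem_uplus mem_bdry; case: (v \in U) => //=.
by apply/flatten_mapP; exists u.
Qed.

Lemma uplus_sub U u : u \in U -> u \in uplus nb U.
Proof. by move=> uU; rewrite mem_uplus uU. Qed.

Lemma spec_ext U f g : (forall v, v \in uplus nb U -> f v = g v) ->
  spec nb h lam U f = spec nb h lam U g.
Proof.
move=> fg; rewrite /spec; congr (_ / _); apply: eq_bigl => F.
  congr (_ && _ && _); apply: eq_forallb => y; case: (boolP (_ \in _)) => //= yU;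
    by rewrite fg // mem_uplus yU ?orbT.
congr (_ && _); apply: eq_forallb => y; case: (boolP (_ \in _)) => //= yU.
by rewrite fg // mem_uplus yU ?orbT.
Qed.

Lemma spec_ge0 U f : 0 <= spec nb h lam U f.
Proof.
by rewrite /spec divr_ge0 // sumr_ge0 // => F _; apply: prodr_ge0 => y _; apply/ltW/lam_gt0.
Qed.

Lemma spec_nonhom U f u v : u \in U -> v \in nb u -> ~~ h (f u) (f v) ->
  spec nb h lam U f = 0.
Proof.
move=> uU vu huv; rewrite /spec big_pred0 ?mul0r // => F.
apply/negP => /andP[/andP[/forallP hF /forallP bF] /forallP oF].
have uW := uplus_sub uU; have vW := uplus_nb uU vu.
have /forallP/(_ (SeqSub vW)) := hF (SeqSub uW); rewrite /= vu /=.
have := oF (SeqSub uW); rewrite /= uU /= => /eqP ->.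
suff -> : F (SeqSub vW) = f v by rewrite (negbTE huv).
have := vW; rewrite mem_uplus => /orP[vU|vB].
  by have := oF (SeqSub vW); rewrite /= vU /= => /eqP ->.
by have := bF (SeqSub vW); rewrite /= vB /= => /eqP ->.
Qed.

(** The weight [b] of the boundary sites is common to all terms and cancels in the quotient. *)
Lemma spec_hom U f : is_hom nb h f -> spec nb h lam U f = weight U f / pfun U f.
Proof.
move=> fh; set W := uplus nb U.
have uW : uniq W by apply: undup_uniq.
have wtE k : \prod_(y : seq_sub W) lam (k (ssval y)) = weight W k.
  by rewrite (prod_seq_sub (fun v => lam (k v)) uW) /weight undup_id.
have UW : {subset U <= W} by move=> v; apply: uplus_sub.
pose b := \prod_(v <- undup W | v \notin U) lam (f v).
have b0 : b != 0 by rewrite gt_eqF //; apply: prodr_gt0 => v _; apply: lam_gt0.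
have wWE (x : {ffun seq_sub U -> 'I_n.+1}) : weight W (glue x f) = weight U (glue x f) * b.
  by rewrite (weight_split _ UW); congr (_ * _); apply: eq_bigr => v /glue_out ->.
have bdN v : v \in bdry nb U -> v \notin U by rewrite mem_bdry => /andP[].
pose hW (F : {ffun seq_sub W -> 'I_n.+1}) :=
  [forall x, forall y, (ssval y \in nb (ssval x)) ==> h (F x) (F y)].
pose oB (F : {ffun seq_sub W -> 'I_n.+1}) :=
  [forall x, (ssval x \in bdry nb U) ==> (F x == f (ssval x))].
pose oU (F : {ffun seq_sub W -> 'I_n.+1}) :=
  [forall x, (ssval x \in U) ==> (F x == f (ssval x))].
have num : \sum_(F | hW F && oB F && oU F) \prod_(y : seq_sub W) lam (F y) = weight U f * b.
  rewrite (big_pred1 (res W f)) => [|F /=].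
    under eq_bigr do rewrite ffunE.
    by rewrite wtE (weight_split _ UW).
  apply/idP/eqP => [/andP[/andP[_ /forallP bF] /forallP uF]|->].
    apply/ffunP => -[v vW]; rewrite ffunE /=; have := vW; rewrite mem_uplus => /orP[vU|vB].
      by have := uF (SeqSub vW); rewrite /= vU => /eqP.
    by have := bF (SeqSub vW); rewrite /= vB => /eqP.
  apply/andP; split; first apply/andP; try split.
  - apply/forallP => x; apply/forallP => y; apply/implyP; rewrite !ffunE; exact: fh.
  - by apply/forallP => x; rewrite ffunE eqxx implybT.
  - by apply/forallP => x; rewrite ffunE eqxx implybT.
(* Edges with no end in [U] are inherited from [f], so homs on the patch with its boundary that
   match [f] on the boundary correspond to homs [glue x f] of the board. *)
have den : \sum_(F | hW F && oB F) \prod_(y : seq_sub W) lam (F y) = pfun U f * b.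
  rewrite /pfun mulr_suml.
  rewrite (reindex_onto (fun x => res W (glue x f)) (fun F => res U (glue F f))) /=.
    apply: eq_big => [x|x _]; last first.
      under eq_bigr do rewrite ffunE.
      by rewrite wtE wWE.
    have -> : res U (glue (res W (glue x f)) f) == x.
      apply/eqP; rewrite -[RHS](res_glue x f); apply/eqP/resP => v /UW vW.
      by rewrite glue_res.
    rewrite andbT; apply/andP/asboolP => [[/forallP hF _] u v vu|gh].
      have E w (wW : w \in W) : res W (glue x f) (SeqSub wW) = glue x f w by rewrite ffunE.
      have [uU|uU] := boolP (u \in U); last have [vU|vU] := boolP (v \in U).
      + have /forallP/(_ (SeqSub (uplus_nb uU vu))) := hF (SeqSub (uplus_sub uU)).
        by rewrite !E /= vu.
      + have uv : u \in nb v by rewrite bnb.1.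
        have /forallP/(_ (SeqSub (uplus_nb vU uv))) := hF (SeqSub (uplus_sub vU)).
        by rewrite !E /= uv hs.
      + by rewrite !glue_out //; apply: fh.
    split; apply/forallP => y.
      by apply/forallP => z; apply/implyP; rewrite !ffunE; apply: gh.
    by apply/implyP => /bdN yU; rewrite ffunE glue_out.
  move=> F /andP[_ /forallP bF]; apply/ffunP => -[v vW]; rewrite ffunE /=.
  have [vU|vU] := boolP (v \in U).
    by rewrite glue_res // -[v in LHS]/(ssval (SeqSub vW)) glue_in.
  rewrite glue_out //; have := vW; rewrite mem_uplus (negbTE vU) /= => vB.
  by have := bF (SeqSub vW); rewrite /= vB => /eqP ->.
rewrite /spec -/W -/(hW _) num den invfM mulrACA divff // mulr1 //.
Qed.

End Weights.

(** * Cylinder sets *)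

(** [M] is the domain of additivity: the measurable sets for a measure, all sets for a finitely
    additive functional. *)
Lemma additive_partition (X : Type) (R : realType) (M : set (set X)) (m : set X -> R)
    (K : finType) (c : X -> K) (A : set X) :
  M set0 -> (forall B C, M B -> M C -> M (B `|` C)) -> m set0 = 0 ->
  (forall B C, M B -> M C -> B `&` C = set0 -> m (B `|` C) = m B + m C) ->
  (forall k, M (A `&` [set x | c x = k])) ->
  m A = \sum_k m (A `&` [set x | c x = k]).
Proof.
move=> M0 MU m0 mU MA.
suff H (s : seq K) : uniq s -> M (A `&` [set x | c x \in s]) /\
    m (A `&` [set x | c x \in s]) = \sum_(k <- s) m (A `&` [set x | c x = k]).
  have [_] := H (index_enum K) (index_enum_uniq K); rewrite -big_enum /= => <-.
  by congr m; apply/seteqP; split=> [x Ax|x []//]; split => //=; rewrite mem_index_enum.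
elim: s => [_|k s IH /= /andP[ks /IH [Ms ms]]].
  have -> : A `&` [set x | c x \in [::]] = set0 by apply/seteqP; split=> x // [].
  by rewrite big_nil.
have -> : A `&` [set x | c x \in k :: s] =
    (A `&` [set x | c x = k]) `|` (A `&` [set x | c x \in s]).
  apply/seteqP; split=> x /=; rewrite inE; first by move=> [Ax /predU1P[]]; [left|right].
  by case=> -[Ax] => [->|->]; rewrite ?eqxx ?orbT.
split; first exact: MU.
rewrite mU ?big_cons ?ms //; apply/seteqP; split=> x // -[[_ /= ->] [_]] /=.
by rewrite (negbTE ks).
Qed.

Section Cylinders.
Context (V : countType) (n : nat).
Implicit Types (U B S T : seq V) (f g : conf V n).

Definition cylset B f : set (Omega V n) := [set g | forall v, v \in B -> g v = f v].

Lemma cylset_ext B f g : (forall v, v \in B -> f v = g v) -> cylset B f = cylset B g.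
Proof. by move=> fg; apply/seteqP; split=> k kf v vB; rewrite kf // fg. Qed.

Lemma cylset_cat B S f : cylset (B ++ S) f = cylset B f `&` cylset S f.
Proof.
apply/seteqP; split=> [k kf|k [kB kS] v].
  by split=> v vB; apply: kf; rewrite mem_cat vB ?orbT.
by rewrite mem_cat => /orP[/kB|/kS].
Qed.

Lemma cylset_eqmem B S f : B =i S -> cylset B f = cylset S f.
Proof. by move=> BS; apply/seteqP; split=> k kf v vB; apply: kf; rewrite ?BS // -BS. Qed.

Lemma cylset_res T (z : {ffun seq_sub T -> 'I_n.+1}) f :
  [set g : Omega V n | res T g = z] = cylset T (glue z f).
Proof.
apply/seteqP; split=> [g <- v vT|g gz]; first by rewrite glue_res.
by rewrite -(res_glue z f); apply/eqP/resP => v; apply: gz.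
Qed.

Lemma cylset_out U B f : (forall v, v \in B -> v \notin U) ->
  <<s @cyl_out V n U >> (cylset B f).
Proof.
rewrite -[<<s _ >>]/(@measurable _ (g_sigma_algebraType (@cyl_out V n U))).
elim: B => [_|v B IH BU].
  have -> : cylset [::] f = setT by apply/seteqP; split.
  exact: measurableT.
have -> : cylset (v :: B) f = [set g | g v = f v] `&` cylset B f.
  apply/seteqP; split=> [k kf|k [kv kB] w].
    by split=> [|w wB]; apply: kf; rewrite inE ?eqxx ?wB ?orbT.
  by rewrite inE => /predU1P[->|/kB].
apply: measurableI; last by apply: IH => w wB; apply: BU; rewrite inE wB orbT.
by apply: sub_sigma_algebra; exists v, (f v); split => //; apply: BU; rewrite inE eqxx.
Qed.

Lemma cyl_out_nil : @cyl_out V n [::] = @cyl V n.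
Proof.
apply/seteqP; split=> A; first by move=> [v [i [_ ->]]]; exists v, i.
by move=> [v [i ->]]; exists v, i.
Qed.

Lemma cyl_out_measurable U A : <<s @cyl_out V n U >> A -> measurable (A : set (Omega V n)).
Proof.
apply: sub_sigma_algebra2 => _ [v [i [_ ->]]]; by exists v, i.
Qed.

Lemma cylset_measurable B f : measurable (cylset B f).
Proof. by apply: (@cyl_out_measurable [::]); apply: cylset_out. Qed.

Lemma measurable_res T (Q : pred {ffun seq_sub T -> 'I_n.+1}) :
  measurable [set g : Omega V n | Q (res T g)].
Proof.
have -> : [set g : Omega V n | Q (res T g)] =
    \bigcup_z (if Q z then [set g | res T g = z] else set0).
  apply/seteqP; split=> [g Qg|g [z _]]; first by exists (res T g) => //=; rewrite Qg.
  by case: ifP => // Qz /= ->.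
apply: countable_bigcupT_measurable; first exact: countableP.
move=> z; case: ifP => _; last exact: measurable0.
by rewrite (cylset_res z (fun=> ord0)); exact: cylset_measurable.
Qed.

Lemma edge_measurable (h : rel 'I_n.+1) u v : measurable [set g : Omega V n | h (g u) (g v)].
Proof.
have uT : u \in [:: u; v] by rewrite inE eqxx.
have vT : v \in [:: u; v] by rewrite !inE eqxx orbT.
have -> : [set g : Omega V n | h (g u) (g v)] =
    [set g | (fun z => h (z (SeqSub uT)) (z (SeqSub vT))) (res [:: u; v] g)].
  by apply/seteqP; split=> g /=; rewrite !ffunE.
exact: (@measurable_res [:: u; v] (fun z => h (z (SeqSub uT)) (z (SeqSub vT)))).
Qed.

Lemma homsetE (h : rel 'I_n.+1) (nb : V -> seq V) : homset nb h =
  ~` \bigcup_k oapp (fun p : V * V =>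
       if p.2 \in nb p.1 then ~` [set g : Omega V n | h (g p.1) (g p.2)] else set0)
     set0 (unpickle k).
Proof.
apply/seteqP; split=> [f fh [k _]|f fN u v vu].
  by case: (unpickle k) => [[u v]|] //=; case: ifP => // vu; apply; apply: fh.
apply: contrapT => nh; apply: fN; exists (pickle (u, v)) => //.
by rewrite pickleK /= vu.
Qed.

Lemma homset_measurable (h : rel 'I_n.+1) (nb : V -> seq V) : measurable (homset nb h).
Proof.
rewrite homsetE; apply: measurableC; apply: bigcupT_measurable => k.
case: (unpickle k) => [[u v]|] /=; last exact: measurable0.
case: ifP => _; last exact: measurable0.
by apply: measurableC; exact: edge_measurable.
Qed.

Lemma cyl_measure_unique (R : realType) U
    (m1 m2 : {measure set (Omega V n) -> \bar R}) :
  (m1 setT < +oo)%E ->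
  (forall B f, (forall v, v \in B -> v \notin U) -> m1 (cylset B f) = m2 (cylset B f)) ->
  forall A, <<s @cyl_out V n U >> A -> m1 A = m2 A.
Proof.
move=> m1fin m12 A.
(* The empty set is included because cylinders with conflicting values have empty intersection, and
   a pi-system is required. *)
pose G : set (set (Omega V n)) :=
  [set A | A = set0 \/ exists B f, (forall v, v \in B -> v \notin U) /\ A = cylset B f].
have GT : G setT by right; exists [::], (fun=> ord0); split => //; apply/seteqP; split.
have sG : <<s @cyl_out V n U >> `<=` <<s G >>.
  apply: sub_sigma_algebra2 => _ [v [i [vU ->]]]; right; exists [:: v], (fun=> i).
  split=> [w|]; first by rewrite inE => /eqP ->.
  apply/seteqP; split=> [g /= gv w|g]; first by rewrite inE => /eqP ->.
  by move=> /(_ v); rewrite inE eqxx; apply.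
move=> /sG; apply: (@g_sigma_algebra_measure_unique _ _ _ G _ (fun=> setT)) => //.
- by move=> _ [->|[B [f [_ ->]]]]; [exact: measurable0|exact: cylset_measurable].
- by apply/seteqP; split=> // x _; exists 0%N.
- move=> _ _ [->|[B [f [BU ->]]]] [->|[B' [f' [BU' ->]]]];
    rewrite ?setI0 ?set0I; try by left.
  have [[g [gf gf']]|ne] := pselect (exists g, cylset B f g /\ cylset B' f' g); last first.
    by left; apply/seteqP; split=> // g [? ?]; apply: ne; exists g.
  right; exists (B ++ B'), g; split=> [v|]; first by rewrite mem_cat => /orP[/BU|/BU'].
  rewrite cylset_cat; congr (_ `&` _); apply: cylset_ext => v vB; symmetry; [exact: gf|exact: gf'].
- by move=> _ [->|[B [f [BU ->]]]]; [rewrite !measure0|exact: m12].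
Qed.

End Cylinders.

Section Pr.
Context {R : realType} (V : countType) (n : nat) (P : probability (Omega V n) R).
Implicit Types (A B : set (Omega V n)).

Definition pr A : R := fine (P A).

Lemma prE A : measurable A -> P A = (pr A)%:E.
Proof. by move=> mA; rewrite /pr fineK // fin_num_measure. Qed.

Lemma pr_ge0 A : 0 <= pr A.
Proof. by rewrite /pr fine_ge0. Qed.

Lemma pr_set0 : pr set0 = 0.
Proof. by rewrite /pr measure0. Qed.

Lemma pr_setT : pr setT = 1.
Proof. by rewrite /pr probability_setT. Qed.

Lemma pr_setU A B : measurable A -> measurable B -> A `&` B = set0 ->
  pr (A `|` B) = pr A + pr B.
Proof.
move=> mA mB AB; rewrite /pr measureU // fineD // fin_num_measure //.
Qed.

Lemma pr_le A B : measurable A -> measurable B -> A `<=` B -> pr A <= pr B.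
Proof.
by move=> mA mB AB; rewrite -lee_fin -!prE //; apply: le_measure; rewrite ?inE.
Qed.

Lemma pr_partition (T : seq V) A : measurable A ->
  pr A = \sum_(z : {ffun seq_sub T -> 'I_n.+1}) pr (A `&` cylset T (glue z (fun=> ord0))).
Proof.
move=> mA; rewrite (@additive_partition _ _ measurable pr _ (res T) A) //.
- by apply: eq_bigr => z _; rewrite (cylset_res z (fun=> ord0)).
- by move=> B C; exact: measurableU.
- exact: pr_set0.
- exact: pr_setU.
by move=> z; apply: measurableI => //; rewrite (cylset_res z (fun=> ord0)); apply: cylset_measurable.
Qed.

Context (h : rel 'I_n.+1) (nb : V -> seq V).
Hypothesis Phom : P (homset nb h) = 1%E.

Lemma pr_nonhom A : measurable A -> (forall f, A f -> ~ is_hom nb h f) -> pr A = 0.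
Proof.
move=> mA AN; have mH := homset_measurable h nb.
have AH : A `<=` ~` homset nb h by move=> f /AN.
apply/eqP; rewrite eq_le pr_ge0 andbT.
apply: le_trans (pr_le mA (measurableC mH) AH) _.
by rewrite /pr probability_setC // [P _]Phom subee //= lexx.
Qed.

End Pr.

(** * Detailed balance *)

Section Balance.
Context {R : realType} {n : nat} {h : rel 'I_n.+1} (V : countType) (nb : V -> seq V)
  (lam : 'I_n.+1 -> R).
Hypotheses (bnb : board nb) (hs : symmetric h) (lam_gt0 : activity lam).
Variable P : probability (Omega V n) R.
Implicit Types (U B : seq V) (f g : conf V n).

Definition outside U B := [seq v <- B | v \notin U].

Lemma mem_outside U B v : (v \in outside U B) = (v \notin U) && (v \in B).
Proof. by rewrite mem_filter. Qed.

(** Detailed balance inside the window [B], in cross-multiplied form because the probabilities may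
    vanish. *)
Definition balanced U B := forall f g, is_hom nb h f -> is_hom nb h g ->
  (forall v, v \notin U -> f v = g v) ->
  pr P (cylset B f) * weight lam U g = pr P (cylset B g) * weight lam U f.

Lemma hom_violation U f k : is_hom nb h k -> (forall v, v \notin U -> f v = k v) ->
  ~ is_hom nb h f -> exists u v, [/\ u \in U, v \in nb u & ~~ h (f u) (f v)].
Proof.
move=> kh fk nf; apply: contrapT => nex; apply: nf => u v vu.
apply/negPn/negP => nh; have [uU|uU] := boolP (u \in U); first by apply: nex; exists u, v.
have [vU|vU] := boolP (v \in U); last by rewrite !fk ?kh in nh.
by apply: nex; exists v, u; rewrite hs bnb.1.
Qed.

Lemma glue_cylset U B (z : {ffun seq_sub U -> 'I_n.+1}) f g : {subset U <= B} ->
  cylset (outside U B) f `&` cylset U (glue z g) = cylset B (glue z f).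
Proof.
move=> UB; apply/seteqP; split=> [k [kf kz] v vB|k kz].
  have [vU|vU] := boolP (v \in U); last by rewrite glue_out // kf // mem_outside vU.
  by rewrite kz // -[v]/(ssval (SeqSub vU)) !glue_in.
split=> v; first by rewrite mem_outside => /andP[vU /kz ->]; rewrite glue_out.
by move=> vU; rewrite kz ?UB // -[v]/(ssval (SeqSub vU)) !glue_in.
Qed.

Section Hom.
Hypothesis Phom : P (homset nb h) = 1%E.

Lemma nonhom_null U B f k : {subset uplus nb U <= B} -> is_hom nb h k ->
  (forall v, v \notin U -> f v = k v) -> ~ is_hom nb h f ->
  pr P (cylset B f) = 0 /\ spec nb h lam U f = 0.
Proof.
move=> UB kh fk nf; have [u [v [uU vu nh]]] := hom_violation kh fk nf.
split; last exact: spec_nonhom nh.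
apply: (pr_nonhom Phom); first exact: cylset_measurable.
move=> g gf gh; move/negP: nh; apply.
rewrite -(gf u) -1?(gf v); first exact: gh.
  exact/UB/(uplus_nb uU).
exact/UB/uplus_sub.
Qed.

Lemma balanced_sum U B f : balanced U B -> {subset uplus nb U <= B} -> is_hom nb h f ->
  pr P (cylset B f) * pfun (h := h) nb lam U f = pr P (cylset (outside U B) f) * weight lam U f.
Proof.
move=> bal UB fh; have UB' : {subset U <= B} by move=> v /(uplus_sub nb)/UB.
rewrite (pr_partition P U (cylset_measurable (outside U B) f)) mulr_suml mulr_sumr.
rewrite [LHS]big_mkcond; apply: eq_bigr => z _; rewrite glue_cylset //.
case: ifPn => /asboolP zh; first by apply: bal => // v vU; rewrite glue_out.
have [->] := nonhom_null UB fh (fun v => @glue_out _ _ U z f v) zh.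
by rewrite mul0r.
Qed.

(** Balance gives the conditional probabilities on cylinders that fix all sites of [B0] off [U]; a
    partition by the values there and uniqueness of measures extend this to every event off [U]. *)
Lemma gibbs_patch_balanced U B0 : {subset uplus nb U <= B0} ->
  (forall B, {subset B0 <= B} -> balanced U B) -> gibbs_patch nb h lam P U.
Proof.
move=> UB0 bal eta A mA; pose T := outside U B0.
pose mix f : conf V n := fun v => if v \in U then eta v else f v.
(* A cylinder without homs is null. Otherwise a hom [k] in it replaces [f], and balance in the
   window [U ++ S] evaluates the probability. *)
have key S f : (forall v, v \in S -> v \notin U) -> {subset T <= S} ->
    pr P (cylset S f `&` cylset U eta) = pr P (cylset S f) * spec nb h lam U (mix f).
  move=> SU TS; have [[k [kh kf]]|ne] := pselect (exists k, is_hom nb h k /\ cylset S f k); last first.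
    have p0 : pr P (cylset S f) = 0.
      by apply: (pr_nonhom Phom); [exact: cylset_measurable|move=> k kf kh; apply: ne; exists k].
    rewrite p0 mul0r; apply/eqP; rewrite eq_le pr_ge0 andbT -p0.
    apply: pr_le => //; try exact: cylset_measurable.
    by apply: measurableI; apply: cylset_measurable.
  have BS : {subset B0 <= U ++ S}.
    move=> v vB; rewrite mem_cat; case: (boolP (v \in U)) => //= vU.
    by apply: TS; rewrite mem_outside vU.
  have UB : {subset uplus nb U <= U ++ S} by move=> v /UB0/BS.
  have mixk v : v \notin U -> mix k v = k v by rewrite /mix => /negbTE ->.
  have mixE v : v \in U ++ S -> mix k v = mix f v.
    rewrite mem_cat /mix; case: (v \in U) => //= /kf; exact.
  have -> : cylset S f `&` cylset U eta = cylset (U ++ S) (mix k).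
    rewrite setIC cylset_cat; congr (_ `&` _); apply: cylset_ext => v vB.
      by rewrite /mix vB.
    by rewrite mixk ?SU // kf.
  have -> : spec nb h lam U (mix f) = spec nb h lam U (mix k).
    by apply: spec_ext => v /UB/mixE.
  have [mh|nm] := pselect (is_hom nb h (mix k)); last first.
    by have [-> ->] := nonhom_null UB kh mixk nm; rewrite mulr0.
  rewrite spec_hom // mulrA; apply: (mulIf (lt0r_neq0 (pfun_gt0 lam_gt0 U mh))).
  rewrite mulfVK ?lt0r_neq0 ?pfun_gt0 // (balanced_sum (bal _ BS) UB mh); congr (_ * _).
  rewrite (@cylset_eqmem _ _ (outside U (U ++ S)) S) => [|v].
    by congr pr; apply: cylset_ext => v vS; rewrite mixk ?SU // kf.
  rewrite mem_outside mem_cat; case: (boolP (v \in U)) => //= vU.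
  by symmetry; apply/negP => /SU; rewrite vU.
have mA' := cyl_out_measurable mA.
have TU v : v \in T -> v \notin U by rewrite mem_outside => /andP[].
pose c (z : {ffun seq_sub T -> 'I_n.+1}) := glue z (fun=> ord0).
(* On a cylinder over [T] the specification is constant, so both sides are finite measures of [A];
   they agree on cylinders off [U] by [key]. *)
have step z : pr P (A `&` cylset U eta `&` cylset T (c z)) =
    pr P (A `&` cylset T (c z)) * spec nb h lam U (mix (c z)).
  have mC := cylset_measurable T (c z).
  have mE : measurable (cylset U eta `&` cylset T (c z)).
    by apply: measurableI => //; exact: cylset_measurable.
  pose s := NngNum (spec_ge0 (h := h) nb lam_gt0 U (mix (c z))).
  pose m1 : {measure set (Omega V n) -> \bar R} := mrestr P mE.
  pose m2 : {measure set (Omega V n) -> \bar R} := mscale s (mrestr P mC).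
  have m1E X : m1 X = P (X `&` (cylset U eta `&` cylset T (c z))) by [].
  have m2E X : m2 X =
    ((spec nb h lam U (mix (c z)))%:E * P (X `&` cylset T (c z)))%E by [].
  suff : m1 A = m2 A.
    rewrite m1E m2E setIA (prE P (measurableI _ _ mA' mC)).
    rewrite (prE P); last by rewrite -setIA; apply: measurableI.
    by rewrite -EFinM => -[->]; rewrite mulrC.
  apply: (@cyl_measure_unique _ _ _ U) mA.
    rewrite m1E setTI; apply: le_lt_trans (probability_le1 P mE) _.
    by rewrite ltry.
  move=> S f SU; rewrite m1E m2E.
  have mS := cylset_measurable S f.
  rewrite (prE P (measurableI _ _ mS mC)) (prE P (measurableI _ _ mS mE)) -EFinM.
  congr (_%:E); rewrite mulrC.
  have [[g [gf gz]]|ne] := pselect (exists g, cylset S f g /\ cylset T (c z) g); last first.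
    have E0 : cylset S f `&` cylset T (c z) = set0.
      by apply/seteqP; split=> // g [? ?]; apply: ne; exists g.
    by rewrite E0 (setIC (cylset U eta)) setIA E0 set0I pr_set0 mul0r.
  have -> : cylset S f = cylset S g by apply: cylset_ext => v /gf.
  have -> : cylset T (c z) = cylset T g by apply: cylset_ext => v /gz.
  have -> : spec nb h lam U (mix (c z)) = spec nb h lam U (mix g).
    apply: spec_ext => v /UB0 vB; rewrite /mix; case: ifPn => // vU.
    by rewrite gz // mem_outside vU.
  rewrite (setIC (cylset U eta)) setIA -cylset_cat; apply: key => v.
    by rewrite mem_cat => /orP[/SU|/TU].
  by rewrite mem_cat => ->; rewrite orbT.
rewrite -[X in A `&` X]/(cylset U eta).
have mAE : measurable (A `&` cylset U eta) by apply: measurableI => //; exact: cylset_measurable.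
rewrite (prE P mAE) (pr_partition P T mAE) (eq_bigr _ (fun z _ => step z)).
transitivity (\int[P]_(f in A)
   (\sum_z (spec nb h lam U (mix (c z)))%:E * (\1_(cylset T (c z)) f)%:E))%E; last first.
  apply: eq_integral => f _; rewrite (bigD1 (res T f)) //= big1 ?adde0 => [|z zf].
    rewrite indicE mem_set ?mule1; last by move=> v vT; rewrite /c glue_res.
    congr (_%:E); apply: spec_ext => v /UB0 vB; rewrite /mix; case: ifPn => // vU.
    by rewrite /c glue_res // mem_outside vU.
  rewrite indicE memNset ?mule0 // => fz; move/eqP: zf; apply.
  by rewrite -(res_glue z (fun=> ord0)); apply/eqP/resP => v vT; rewrite fz.
rewrite ge0_integral_sum //; first last.
- by move=> z f _; rewrite mule_ge0 // lee_fin ?spec_ge0.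
- move=> z; apply: measurable_funeM; apply/measurable_EFinP; apply: measurable_indic.
  exact: cylset_measurable.
rewrite -sumEFin; apply: eq_bigr => z _.
have mC := cylset_measurable T (c z).
rewrite ge0_integralZl_EFin //; first last.
- exact: spec_ge0.
- by apply/measurable_EFinP; exact: measurable_indic.
rewrite integral_indic // (setIC (cylset T (c z)) A) mulrC EFinM; congr (_ * _)%E.
exact/esym/(prE P (measurableI _ _ mA' mC)).
Qed.

End Hom.

(** Test the Gibbs condition on a cylinder over [B] off [U]: the integrand is constant there, and
    the remaining factors coincide for [f] and [g]. *)
Lemma gibbs_patch_balance U B : gibbs_patch nb h lam P U -> {subset uplus nb U <= B} ->
  balanced U B.
Proof.
move=> gp UB.
have UB' : {subset U <= B} by move=> v /(uplus_sub nb)/UB.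
have H f : is_hom nb h f -> pr P (cylset B f) =
    pr P (cylset (outside U B) f) * (weight lam U f / pfun (h := h) nb lam U f).
  move=> fh; set S := outside U B.
  have SU v : v \in S -> v \notin U by rewrite mem_outside => /andP[].
  have mS := cylset_measurable S f.
  have := gp f _ (cylset_out f SU); rewrite -[X in _ `&` X]/(cylset U f).
  have -> : cylset S f `&` cylset U f = cylset B f.
    apply/seteqP; split=> [g [gS gU] v vB|g gB]; last first.
      by split=> v; [rewrite mem_outside => /andP[_ /gB]|move=> /UB'/gB].
    by have [/gU//|vU] := boolP (v \in U); apply: gS; rewrite mem_outside vU.
  rewrite (prE P (cylset_measurable B f)).
  rewrite (eq_integral (cst (spec nb h lam U f)%:E)) => [|g /set_mem gS].
    rewrite integral_cst // => e.
    have : (pr P (cylset B f))%:E =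
        ((spec nb h lam U f)%:E * (pr P (cylset S f))%:E)%E.
      by rewrite e; congr (_ * _)%E; exact: prE.
    by rewrite -EFinM => -[->]; rewrite spec_hom // mulrC.
  congr (_%:E); apply: spec_ext => v /UB vB; case: ifPn => // vU.
  by rewrite gS // mem_outside vU.
move=> f g fh gh fg; rewrite !H // (pfun_ext _ _ fg).
rewrite (@cylset_ext _ _ (outside U B) f g); first by ring.
by move=> v; rewrite mem_outside => /andP[/fg].
Qed.

End Balance.

(** * Existence of Gibbs measures *)

Section ProbabilityOfMeasure.
Context (R : realType) d (T : measurableType d) (m : {measure set T -> \bar R}).

(** A copy of [m] indexed by the proof of total mass 1, so that the probability structure can be
    attached to it. *)
Definition unit_measure of m setT = 1%E : set T -> \bar R := m.

Variable m1 : m setT = 1%E.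

HB.instance Definition _ := isMeasure.Build d T R (unit_measure m1)
  (measure0 m) (@measure_ge0 _ _ _ m) (@measure_semi_sigma_additive _ _ _ m).
HB.instance Definition _ := Measure_isProbability.Build d T R (unit_measure m1) m1.

Lemma probability_of_measure : exists P : probability T R, forall A, P A = m A.
Proof. by exists (unit_measure m1 : probability T R). Qed.

End ProbabilityOfMeasure.

Lemma distribution_exists (R : realType) d d' (T : measurableType d) (T' : measurableType d')
    (P : probability T R) (X : T -> T') : measurable_fun setT X ->
  exists Q : probability T' R, forall A, Q A = P (X @^-1` A).
Proof.
move=> mX; pose Xm : {mfun T >-> T'} := HB.pack X (isMeasurableFun.Build d d' T T' X mX).
by exists (distribution P Xm).
Qed.

(* The measure is the image of Lebesgue measure on [0, 1[ under the map that reads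
   off the colours from nested intervals of lengths [L (wordset s)]. *)
Section Extension.
Context {R : realType} (V : countType) (n : nat) (L : set (conf V n) -> R).
Hypotheses (L1 : L setT = 1) (L0 : forall A, 0 <= L A)
  (LU : forall A B, A `&` B = set0 -> L (A `|` B) = L A + L B).

Local Notation I := 'I_n.+1.

(** Numbers that code no site receive the colour [ord0], so that words have a letter at every
    position. *)
Let coord k (f : conf V n) : I := oapp f ord0 (pickle_inv k).

(* Words are stored with the most recent letter first. *)
Fixpoint wordset (s : seq I) : set (conf V n) :=
  if s is i :: s' then wordset s' `&` [set f | coord (size s') f = i] else setT.

Let p s := L (wordset s).

Lemma L_set0 : L set0 = 0.
Proof. by have := LU (setI0 set0); rewrite setU0; lra. Qed.

Lemma L_partition (A : set (conf V n)) k :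
  L A = \sum_(i : I) L (A `&` [set f | coord k f = i]).
Proof.
apply: (@additive_partition _ _ (fun=> True) L _ (coord k) A) => //; last first.
  by move=> B C _ _; apply: LU.
exact: L_set0.
Qed.

Let cumul s (i : I) := \sum_(j : I | (j < i)%N) p (j :: s).

Fixpoint left_end (s : seq I) : R :=
  if s is i :: s' then left_end s' + cumul s' i else 0.

Definition word_itv s (x : R) := left_end s <= x < left_end s + p s.

Lemma p_sum s : p s = \sum_(i : I) p (i :: s).
Proof. exact: L_partition. Qed.

Lemma cumul_split s (i : I) : cumul s i + p (i :: s) = \sum_(j : I | (j <= i)%N) p (j :: s).
Proof.
rewrite (bigD1 i) //= addrC; congr (_ + _); apply: eq_bigl => j.
by rewrite ltn_neqAle andbC.
Qed.

Lemma cumul_le s (i j : I) : (i < j)%N -> cumul s i + p (i :: s) <= cumul s j.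
Proof.
move=> ij; rewrite cumul_split /cumul [leRHS](bigID (fun k : I => (k <= i)%N)) /=.
rewrite -[leLHS]addr0; apply: lerD; last by apply: sumr_ge0 => k _; apply: L0.
rewrite le_eqVlt; apply/orP; left; apply/eqP/eq_bigl => k.
by case: (leqP k i) => ki; rewrite ?andbT ?andbF // (leq_ltn_trans ki ij).
Qed.

Lemma cumul_total s (i : I) : cumul s i + p (i :: s) <= p s.
Proof.
rewrite cumul_split p_sum [leRHS](bigID (fun k : I => (k <= i)%N)) /=.
by rewrite lerDl; apply: sumr_ge0 => k _; apply: L0.
Qed.

Lemma word_itv_sub i s x : word_itv (i :: s) x -> word_itv s x.
Proof.
rewrite /word_itv /= => /andP[lx xr]; apply/andP; split.
  by apply: le_trans lx; rewrite lerDl; apply: sumr_ge0 => k _; apply: L0.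
by apply: lt_le_trans xr _; rewrite -addrA lerD2l cumul_total.
Qed.

Lemma word_itv_uniq i j s x : word_itv (i :: s) x -> word_itv (j :: s) x -> i = j.
Proof.
wlog ij : i j / (i <= j)%N.
  by move=> H ix jx; case: (leqP i j) => [/H|/ltnW/H ->]//; apply.
rewrite /word_itv /= => /andP[_ xi] /andP[jx _]; apply/val_inj/eqP => /=.
rewrite eqn_leq ij /= leqNgt; apply/negP => /(cumul_le s) H.
by have := lt_le_trans xi (le_trans _ jx); rewrite -addrA lerD2l H ltxx => /(_ isT).
Qed.

Lemma word_itv_child s x : word_itv s x -> exists i, word_itv (i :: s) x.
Proof.
move=> /andP[lx xr].
pose Q (k : nat) := x < left_end s + \sum_(j : I | (j <= k)%N) p (j :: s).
have exQ : exists k, Q k.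
  exists n; apply: lt_le_trans xr _; rewrite lerD2l p_sum le_eqVlt; apply/orP; left.
  by apply/eqP/eq_bigl => j; rewrite -ltnS ltn_ord.
case: (ex_minnP exQ) => m Qm mmin.
have mn : (m < n.+1)%N.
  rewrite ltnS; apply: mmin; apply: lt_le_trans xr _; rewrite lerD2l p_sum.
  by rewrite le_eqVlt; apply/orP; left; apply/eqP/eq_bigl => j; rewrite -ltnS ltn_ord.
exists (Ordinal mn); rewrite /word_itv /= -addrA cumul_split.
apply/andP; split; last exact: Qm.
rewrite /cumul /=.
case: m Qm mmin mn => [|m] _ mmin _; first by rewrite big_pred0 ?addr0.
rewrite leNgt; apply/negP => Qm; suff /mmin : Q m by rewrite ltnn.
exact: Qm.
Qed.

Definition digit s (x : R) : I := odflt ord0 [pick i | word_itv (i :: s) x].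

Lemma digitP s x i : word_itv s x -> (digit s x == i) = word_itv (i :: s) x.
Proof.
move=> sx; rewrite /digit; case: pickP => [j jx|H] /=; last first.
  by have [j] := word_itv_child sx; rewrite H.
by apply/eqP/idP => [<-//|ix]; apply: word_itv_uniq jx ix.
Qed.

Fixpoint prefix (x : R) k : seq I :=
  if k is k'.+1 then digit (prefix x k') x :: prefix x k' else [::].

Lemma size_prefix x k : size (prefix x k) = k.
Proof. by elim: k => //= k ->. Qed.

Lemma word_itv_prefix x k : word_itv [::] x -> word_itv (prefix x k) x.
Proof. by move=> x0; elim: k => //= k IH; rewrite -digitP. Qed.

Lemma word_itv_root s x : word_itv s x -> word_itv [::] x.
Proof. by elim: s => // i s IH /word_itv_sub/IH. Qed.

Lemma prefixE s x : word_itv s x -> prefix x (size s) = s.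
Proof.
elim: s => //= i s IH isx; have sx := word_itv_sub isx; rewrite IH //.
by congr (_ :: _); apply/eqP; rewrite digitP.
Qed.

Let X (x : R) : Omega V n := fun v => if word_itv [::] x
  then digit (prefix x (pickle v)) x else ord0.

Lemma itv_measurable s : measurable ([set x | word_itv s x] : set (measurableTypeR R)).
Proof.
have -> : [set x | word_itv s x] = `[left_end s, left_end s + p s[%classic.
  by apply/seteqP; split=> x; rewrite /word_itv /= in_itv.
exact: measurable_itv.
Qed.

Lemma X_measurable : measurable_fun (setT : set (measurableTypeR R)) X.
Proof.
apply: (@measurability _ _ _ _ setT X (@cyl V n)) => //.
move=> _ [_ [v [i ->]] <-]; rewrite setTI.
set k := pickle v.
have -> : X @^-1` [set f | f v = i] =
    (\bigcup_(s : seq I) (if size s == k then [set x | word_itv (i :: s) x] else set0)) `|`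
    (if i == ord0 then ~` [set x | word_itv [::] x] else set0).
  apply/seteqP; split=> x /=.
    rewrite /X; case: ifPn => x0 xi; last by right; rewrite -xi eqxx /=; exact/negP.
    left; exists (prefix x k) => //=; rewrite size_prefix eqxx /= -digitP ?xi //.
    exact: word_itv_prefix.
  case=> [[s _]|]; last by case: eqP => // -> /negP x0; rewrite /X (negbTE x0).
  case: eqP => // sk /= isx; have sx := word_itv_sub isx.
  rewrite /X (word_itv_root sx) -/k -sk (prefixE sx); apply/eqP; by rewrite digitP.
apply: measurableU; last first.
  by case: ifP => _; [apply: measurableC; exact: itv_measurable|exact: measurable0].
apply: countable_bigcupT_measurable; first exact: countableP.
by move=> s; case: ifP => _; [exact: itv_measurable|exact: measurable0].
Qed.

(** Finite additivity of [L] suffices: it fixes the lengths of the intervals, and countable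
    additivity comes from Lebesgue measure. *)
Lemma extension : exists P : probability (Omega V n) R,
  forall S f, pr P (cylset S f) = L (cylset S f).
Proof.
have mD := itv_measurable [::].
pose leb := (@lebesgue_measure R).
have lebE s : leb [set x | word_itv s x] = (p s)%:E.
  have -> : [set x | word_itv s x] = [set` `[left_end s, left_end s + p s[].
    by apply/seteqP; split=> x; rewrite /word_itv /= in_itv.
  rewrite /leb lebesgue_measure_itv /= lte_fin ltrDl; case: ltP => ps.
    by rewrite -EFinB addrC addKr.
  by congr (_%:E); apply/eqP; rewrite eq_le L0 ps.
have m1 : mrestr leb mD setT = 1%E by rewrite /mrestr setTI lebE /p /= L1.
have [P0 P0E] := probability_of_measure m1.
have [P PE] := distribution_exists P0 X_measurable.
exists P => S f.
pose M := (\max_(v <- S) pickle v).+1.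
have SM v : v \in S -> (pickle v < M)%N.
  by move=> vS; rewrite ltnS; apply: (@leq_bigmax_seq _ S xpredT (fun v => pickle v) v vS isT).
have mE : measurable (X @^-1` cylset S f).
  rewrite -[X in measurable X]setTI; apply: X_measurable => //; exact: cylset_measurable.
pose m (A : set (measurableTypeR R)) : R := fine (P0 A).
(* Induction on the number of missing letters: a word of length [M] decides all sites of [S], and a
   shorter word is split by its next letter. *)
have key j s : (size s + j)%N = M ->
    m (X @^-1` cylset S f `&` [set x | word_itv s x]) = L (cylset S f `&` wordset s).
  elim: j s => [|j IH] s sM.
    rewrite addn0 in sM.
    have wordP g (v : V) : wordset s g -> v \in S ->
        g v = nth ord0 s (size s - (pickle v).+1).
      move=> gs vS; have := SM _ vS; rewrite -sM.
      have -> : g v = coord (pickle v) g by rewrite /coord pickleK_inv.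
      elim: s gs {sM} => //= i s IH [gs gi]; rewrite ltnS leq_eqVlt => /predU1P[->|vs].
        by rewrite subnn /= gi.
      by rewrite subSS -(subnSK vs) /= IH.
    have XP x (v : V) : word_itv s x -> v \in S ->
        X x v = nth ord0 s (size s - (pickle v).+1).
      move=> sx vS; rewrite /X (word_itv_root sx); have := SM _ vS; rewrite -sM.
      elim: s sx {sM wordP} => //= i s IH isx; rewrite ltnS leq_eqVlt.
      have sx := word_itv_sub isx.
      case/predU1P => [->|vs].
        by rewrite subnn /= (prefixE sx); apply/eqP; rewrite digitP.
      by rewrite subSS -(subnSK vs) /= IH.
    have [comp|ncomp] := pselect (forall v, v \in S -> nth ord0 s (size s - (pickle v).+1) = f v).
      have -> : X @^-1` cylset S f `&` [set x | word_itv s x] = [set x | word_itv s x].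
        by apply/seteqP; split=> [x [] //|x sx]; split => // v vS; rewrite /= XP // comp.
      have -> : cylset S f `&` wordset s = wordset s.
        by apply/seteqP; split=> [x [] //|x sx]; split => // v vS; rewrite /= (wordP x) // comp.
      rewrite /m P0E /= /mrestr.
      suff -> : [set x | word_itv s x] `&` [set x | word_itv [::] x] = [set x | word_itv s x].
        exact: (congr1 fine (lebE s)).
      by apply/seteqP; split=> [x [] //|x sx]; split => //; apply: word_itv_root sx.
    have -> : X @^-1` cylset S f `&` [set x | word_itv s x] = set0.
      apply/seteqP; split=> x // [xS sx]; apply: ncomp => v vS.
      by rewrite -(XP x) //; apply: xS.
    suff -> : cylset S f `&` wordset s = set0 by rewrite L_set0 /m measure0.
    apply/seteqP; split=> x // [xS sx]; apply: ncomp => v vS.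
    by rewrite -(wordP x) //; apply: xS.
  rewrite (L_partition _ (size s)).
  rewrite (@additive_partition _ _ (@measurable _ (measurableTypeR R)) m _ (digit s)).
  - apply: eq_bigr => i _; rewrite -!setIA -/(wordset (i :: s)) -IH; last by rewrite /= -sM; lia.
    congr (m (_ `&` _)); apply/seteqP; split=> x /=.
      by move=> [sx /eqP]; rewrite digitP.
    by move=> isx; have sx := word_itv_sub isx; split => //; apply/eqP; rewrite digitP.
  - exact: measurable0.
  - by move=> B C; exact: measurableU.
  - by rewrite /m measure0.
  - move=> B C mB mC BC; rewrite /m measureU // fineD // fin_num_measure //.
  move=> i; rewrite -setIA.
  suff -> : [set x | word_itv s x] `&` [set x | digit s x = i] = [set x | word_itv (i :: s) x].
    by apply: measurableI => //; exact: itv_measurable.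
  apply/seteqP; split=> x /=; first by move=> [sx /eqP]; rewrite digitP.
  by move=> isx; have sx := word_itv_sub isx; split => //; apply/eqP; rewrite digitP.
have := key M [::] erefl; rewrite /= setIT => <-.
rewrite /pr PE /m; congr fine; rewrite !P0E /= /mrestr; congr leb.
by rewrite -setIA setIid.
Qed.

End Extension.

Definition bounded_seq (R : realType) (u : nat -> R) := exists M, forall k, `|u k| <= M.

(* Take limits along an ultrafilter refining the filter of cofinite sets. *)
Lemma generalized_limit (R : realType) : exists Lim : (nat -> R) -> R,
  [/\ forall u v, bounded_seq u -> bounded_seq v -> Lim (fun k => u k + v k) = Lim u + Lim v,
      forall u c, bounded_seq u -> Lim (fun k => u k * c) = Lim u * c,
      forall u, bounded_seq u -> (forall k, 0 <= u k) -> 0 <= Lim u,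
      (forall u c, (exists N, forall k, (N <= k)%N -> u k = c) -> Lim u = c)
    & (forall u v, (exists N, forall k, (N <= k)%N -> u k = v k) ->
        bounded_seq u -> Lim u = Lim v)].
Proof.
have [G [GU sFG]] := @ultraFilterLemma nat (nbhs \oo) _.
(* Compactness of [-M, M] gives a cluster point, which along an ultrafilter is a limit. *)
have cv (u : nat -> R) : bounded_seq u -> cvg (u @ G).
  move=> [M uM].
  have GM : G (u @^-1` `[- M, M]).
    by apply: filterS filterT => k _ /=; rewrite in_itv /= -ler_norml.
  have [p [_ pc]] := @segment_compact R (- M) M (u @ G) _ GM.
  apply/cvg_ex; exists p => W Wp.
  have [//|GnW] := in_ultra_setVsetC (u @^-1` W) GU.
  by have [x []] := pc (~` W) W GnW Wp.
have near_G (Q : nat -> Prop) : (exists N, forall k, (N <= k)%N -> Q k) -> G [set k | Q k].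
  by move=> [N NQ]; apply: sFG; exists N.
exists (fun u => lim (u @ G)); split.
- by move=> u v bu bv; apply: cvg_lim => //; apply: cvgD; apply: cv.
- by move=> u c bu; apply: cvg_lim => //; apply: cvgMr_tmp; apply: cv.
- by move=> u bu u0; apply: limr_ge; [exact: cv|exact: nearW].
- by move=> u c uc; apply: cvg_lim => //; apply: cvg_near_cst; apply: near_G.
move=> u v uv bu; apply/esym/cvg_lim => //.
have bd : (fun k => v k - u k) @ G --> (0 : R).
  apply: cvg_near_cst; apply: near_G; have [N uvN] := uv; exists N => k /uvN ->.
  by rewrite subrr.
have := cvgD bd (cv _ bu); rewrite add0r.
suff -> : (fun k => v k - u k) + u = v by apply.
by apply/funext => k; rewrite fctE subrK.
Qed.

(** * Gibbs measures as limits of finite-volume measures *)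

Section Existence.
Context {R : realType} {n : nat} {h : rel 'I_n.+1} (V : countType) (nb : V -> seq V)
  (lam : 'I_n.+1 -> R).
Hypotheses (bnb : board nb) (hs : symmetric h) (lam_gt0 : activity lam).
Variable f0 : V -> 'I_n.+1.
Hypothesis f0h : is_hom nb h f0.

Definition box N : seq V := pmap pickle_inv (iota 0 N).

Lemma mem_box N v : (v \in box N) = (pickle v < N)%N.
Proof.
rewrite mem_pmap; apply/mapP/idP => [[k]|vN].
  rewrite mem_iota /= add0n => kN e; have := @pickle_invK V k.
  by rewrite -e /= => ->.
by exists (pickle v); rewrite ?pickleK_inv // mem_iota add0n.
Qed.

Lemma sub_box (S : seq V) : exists N, forall k, (N <= k)%N -> {subset S <= box k}.
Proof.
exists (\max_(v <- S) pickle v).+1 => k Nk v vS; rewrite mem_box; apply: leq_trans Nk.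
by rewrite ltnS; apply: (@leq_bigmax_seq _ S xpredT (fun v => pickle v) v vS isT).
Qed.

Definition mass B (A : set (conf V n)) : R :=
  \sum_(x : {ffun seq_sub B -> 'I_n.+1} |
        `[< is_hom nb h (glue x f0) /\ A (glue x f0) >]) weight lam B (glue x f0).

Lemma mass_ge0 B A : 0 <= mass B A.
Proof. by apply: sumr_ge0 => x _; apply/ltW/weight_gt0. Qed.

Lemma massT B : mass B setT = pfun (h := h) nb lam B f0.
Proof.
by apply: eq_bigl => x; apply/asboolP/asboolP => [[]|].
Qed.

Lemma massU B A A' : A `&` A' = set0 -> mass B (A `|` A') = mass B A + mass B A'.
Proof.
move=> AB; rewrite /mass !(big_mkcond (fun x => `[< _ >])) -big_split /=.
apply: eq_bigr => x _; set k := glue x f0.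
have AB' : A k -> A' k -> False.
  by move=> Ak Bk; have : (A `&` A') k by []; rewrite AB.
do !case: asboolP; rewrite ?addr0 ?add0r //; try tauto.
Qed.

Definition splice (U : seq V) (g k : conf V n) : conf V n :=
  fun v => if v \in U then g v else k v.

Lemma splice_hom U B f g k : {subset uplus nb U <= B} -> is_hom nb h g ->
  is_hom nb h k -> cylset B f k -> (forall v, v \notin U -> f v = g v) ->
  is_hom nb h (splice U g k).
Proof.
move=> UB gh kh kf fg.
have spB v : v \in B -> splice U g k v = g v.
  by move=> vB; rewrite /splice; case: ifPn => // vU; rewrite kf // fg.
move=> u v vu; have [uU|uU] := boolP (u \in U).
  by rewrite !spB; [apply: gh|apply/UB/(uplus_nb uU vu)|apply/UB/uplus_sub].
have [vU|vU] := boolP (v \in U); last by rewrite /splice (negbTE uU) (negbTE vU); apply: kh.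
have uv : u \in nb v by rewrite bnb.1.
by rewrite !spB; [apply: gh|apply/UB/uplus_sub|apply/UB/(uplus_nb vU uv)].
Qed.

(** Overwriting [U] by [g] is a bijection from the homs matching [f] on [B] to those matching [g],
    with inverse overwriting by [f]; the window [B] contains the neighbours of [U], so homs are
    preserved. *)
Lemma mass_balanced W U B f g : {subset U <= W} -> {subset uplus nb U <= B} ->
  is_hom nb h f -> is_hom nb h g -> (forall v, v \notin U -> f v = g v) ->
  mass W (cylset B f) * weight lam U g = mass W (cylset B g) * weight lam U f.
Proof.
move=> UN UB fh gh fg.
have UB' : {subset U <= B} by move=> v /(uplus_sub nb)/UB.
pose Phi g (x : {ffun seq_sub W -> 'I_n.+1}) := res W (splice U g (glue x f0)).
have gPhi k x : glue (Phi k x) f0 = splice U k (glue x f0).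
  apply: glue_res_id => v vW; rewrite /splice ifN; first exact: glue_out.
  by apply: contra vW => /UN.
have spsp k1 k2 k : splice U k1 (splice U k2 k) = splice U k1 k.
  by apply/funext => v; rewrite /splice; case: (v \in U).
have spid B' k1 k : {subset U <= B'} -> cylset B' k1 k -> splice U k1 k = k.
  by move=> UB1 kk; apply/funext => v; rewrite /splice; case: ifP => // /UB1/kk.
have fwd f1 g1 x : is_hom nb h g1 -> (forall v, v \notin U -> f1 v = g1 v) ->
    is_hom nb h (glue x f0) /\ cylset B f1 (glue x f0) ->
    is_hom nb h (glue (Phi g1 x) f0) /\ cylset B g1 (glue (Phi g1 x) f0).
  move=> g1h fg1 [xh xf]; rewrite gPhi; split; first exact: splice_hom xf fg1.
  by move=> v vB; rewrite /splice; case: ifPn => // vU; rewrite xf // fg1.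
have PhiK f1 g1 x : cylset B f1 (glue x f0) -> Phi f1 (Phi g1 x) = x.
  by move=> xf; rewrite /Phi gPhi spsp (spid B) // res_glue.
rewrite /mass (reindex_onto (Phi f) (Phi g)) /=; last first.
  by move=> x /asboolP [_ xf]; apply: PhiK.
rewrite !mulr_suml; apply: eq_big => [x|x /andP[_ /eqP xx]].
  apply/andP/asboolP => [[/asboolP xf /eqP xx]|xg]; first by rewrite -xx; apply: fwd xf.
  split; last by rewrite (PhiK g f) //; case: xg.
  by apply/asboolP; apply: fwd xg => // v /fg.
have gx : glue x f0 = splice U g (glue x f0) by rewrite -{1}xx !gPhi spsp.
rewrite gPhi (@weight_ext _ _ _ lam U g (glue x f0)) => [|v vU]; last by rewrite gx /splice vU.
rewrite (weight_ratio (g := glue x f0) _ UN) => [|v vU]; last by rewrite /splice (negbTE vU).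
by congr (_ * _); apply: weight_ext => v vU; rewrite /splice vU.
Qed.

Lemma pr_determined (L : set (conf V n) -> R) (P : probability (Omega V n) R) (T : seq V)
    (Q : pred {ffun seq_sub T -> 'I_n.+1}) :
  L set0 = 0 -> (forall A B, A `&` B = set0 -> L (A `|` B) = L A + L B) ->
  (forall S f, pr P (cylset S f) = L (cylset S f)) ->
  pr P [set g | Q (res T g)] = L [set g | Q (res T g)].
Proof.
move=> L0 LU PL; have mQ := @measurable_res V n T Q.
rewrite (pr_partition P T mQ) (@additive_partition _ _ (fun=> True) L _ (res T) [set g | Q (res T g)]) //;
  last by move=> A B _ _; apply: LU.
apply: eq_bigr => z _; rewrite (cylset_res z (fun=> ord0)).
have [Qz|nQz] := boolP (Q z).
  suff -> : [set g | Q (res T g)] `&` cylset T (glue z (fun=> ord0)) =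
    cylset T (glue z (fun=> ord0)) by [].
  by rewrite -cylset_res; apply/seteqP; split=> [g []|g /= gz]//; rewrite gz.
suff -> : [set g | Q (res T g)] `&` cylset T (glue z (fun=> ord0)) = set0 by rewrite L0 pr_set0.
by rewrite -cylset_res; apply/seteqP; split=> // g [/= Qg gz]; move: nQz; rewrite -gz Qg.
Qed.

(** The second conclusion keeps track of the boundary condition: every configuration charged in
    finite volume agrees with [f0] off a box. It will separate Gibbs measures on the tree. *)
Lemma gibbs_exists : exists P : probability (Omega V n) R, gibbs nb h lam P /\
  forall u (Q : pred 'I_n.+1),
    (forall k, is_hom nb h k -> (exists s : seq V, forall v, v \notin s -> k v = f0 v) -> Q (k u)) ->
    pr P [set g | Q (g u)] = 1.
Proof.
have [Lim [LimD LimM Lim_ge0 Lim_cst Lim_eq]] := generalized_limit R.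
pose Z N := pfun (h := h) nb lam (box N) f0.
have Z0 N : 0 < Z N by exact: pfun_gt0.
pose mu N A := mass (box N) A / Z N.
have muU N A B : A `&` B = set0 -> mu N (A `|` B) = mu N A + mu N B.
  by move=> AB; rewrite /mu massU // mulrDl.
have muT N : mu N setT = 1 by rewrite /mu massT divff //; exact/lt0r_neq0/Z0.
have mu_ge0 N A : 0 <= mu N A by rewrite divr_ge0 ?mass_ge0 // ltW.
have mu_bd A : bounded_seq (mu ^~ A).
  exists 1 => N; rewrite ger0_norm // -(muT N) -(setvU A) muU ?setICl //.
  by rewrite lerDr.
pose L A := Lim (mu ^~ A).
have LU A B : A `&` B = set0 -> L (A `|` B) = L A + L B.
  move=> AB; rewrite /L -LimD //; congr Lim; apply/funext => N; exact: muU.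
have L1 : L setT = 1 by apply: Lim_cst; exists 0%N => k _; apply: muT.
have L_ge0 A : 0 <= L A by apply: Lim_ge0.
have [P PL] := extension L1 L_ge0 LU.
have Lsure A : (forall k, is_hom nb h k ->
    (exists s : seq V, forall v, v \notin s -> k v = f0 v) -> A k) -> L A = 1.
  move=> sure; apply: Lim_cst; exists 0%N => N _; rewrite -(muT N) /mu /mass; congr (_ / _).
  apply: eq_bigl => x; apply/asboolP/asboolP => -[xh _]; split => //.
  by apply: sure => //; exists (box N) => v vN; rewrite glue_out.
have det (T : seq V) (Q : pred {ffun seq_sub T -> 'I_n.+1}) : pr P [set g | Q (res T g)] = L [set g | Q (res T g)].
  by apply: pr_determined => //; apply: L_set0.
(* The value of [L] on [homset] does not transfer to [P], since infinitely many sites are involved.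
   A single edge is an event on two sites, and non-homs form a countable union of null sets. *)
have Phom : P (homset nb h) = 1%E.
  set H := homset nb h; have mH : measurable H by exact: homset_measurable.
  suff H0 : P (~` H) = 0%E.
    by rewrite -(setCK H); transitivity (1 - P (~` H))%E;
      [apply: probability_setC; exact: measurableC|rewrite H0 sube0].
  apply/negligibleP; first exact: measurableC.
  rewrite /H homsetE setCK.
  apply: negligible_bigcup => k; case: (unpickle k) => [[u v]|] /=; last exact: negligible_set0.
  case: ifP => vu; last exact: negligible_set0.
  have mE : measurable [set g : Omega V n | h (g u) (g v)] by exact: edge_measurable.
  apply/negligibleP; first exact: measurableC.
  transitivity (1 - P [set g : Omega V n | h (g u) (g v)])%E; first exact: probability_setC.
  suff e : pr P [set g : Omega V n | h (g u) (g v)] = 1 by rewrite (prE P mE) e -EFinB subrr.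
  have uT : u \in [:: u; v] by rewrite inE eqxx.
  have vT : v \in [:: u; v] by rewrite !inE eqxx orbT.
  have E : [set g : Omega V n | h (g u) (g v)] =
      [set g | (fun z => h (z (SeqSub uT)) (z (SeqSub vT))) (res [:: u; v] g)].
    by apply/seteqP; split=> g /=; rewrite !ffunE.
  rewrite E (det _ (fun z => h (z (SeqSub uT)) (z (SeqSub vT)))) -E.
  by apply: Lsure => k' kh _; apply: kh.
exists P; split; last first.
  move=> u Q sure.
  have uT : u \in [:: u] by rewrite inE eqxx.
  have E : [set g : Omega V n | Q (g u)] =
      [set g | (fun z => Q (z (SeqSub uT))) (res [:: u] g)].
    by apply/seteqP; split=> g /=; rewrite !ffunE.
  by rewrite E (det _ (fun z => Q (z (SeqSub uT)))) -E; apply: Lsure.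
split=> // U; apply: (@gibbs_patch_balanced _ _ _ _ _ _ bnb hs lam_gt0 P Phom U (uplus nb U)) => //.
(* Balance holds in every box that contains [U], so it survives the limit. *)
move=> B UB f g fh gh fg; rewrite !PL /L -!LimM //.
apply: Lim_eq; last by have [M HM] := mu_bd (cylset B f); exists (M * weight lam U g) => k;
  rewrite normrM (gtr0_norm (weight_gt0 lam_gt0 _ _)) ler_pM2r ?weight_gt0.
have [N HN] := sub_box U; exists N => k /HN UN.
by rewrite /mu mulrAC (mass_balanced UN UB fh gh fg) mulrAC.
Qed.

End Existence.

(** * One-site updates *)

Section OneSite.
Context {R : realType} {n : nat} {h : rel 'I_n.+1} (V : countType) (nb : V -> seq V)
  (lam : 'I_n.+1 -> R).
Hypotheses (bnb : board nb) (hs : symmetric h) (lam_gt0 : activity lam).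

(** Sites off [U] contribute equal factors. With weights over the common window [B] the relation can
    be chained along moves at different sites. *)
Lemma balance_weight (U B : seq V) (f g : V -> 'I_n.+1) (a b : R) : {subset U <= B} ->
  (forall v, v \notin U -> f v = g v) ->
  a * weight lam U g = b * weight lam U f <-> a * weight lam B g = b * weight lam B f.
Proof.
move=> UB fg; have ratio := weight_ratio lam UB fg.
have f0 := weight_gt0 lam_gt0 U f; have g0 := weight_gt0 lam_gt0 B g.
split=> e.
  apply: (mulIf (lt0r_neq0 f0)); rewrite -mulrA -ratio mulrCA e; ring.
apply: (mulIf (lt0r_neq0 g0)); rewrite mulrAC e mulrAC -!mulrA; congr (_ * _).
by rewrite mulrC ratio mulrC.
Qed.

Lemma one_site_gibbs N rho x0 rk (P : probability (Omega V n) R) :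
  collapse (h := h) N rho x0 rk -> P (homset nb h) = 1%E -> one_site nb h lam P ->
  gibbs nb h lam P.
Proof.
move=> ctr Phom os; split=> // U.
(* The moves take place within radius [N] of [U], and balance at a site also involves its
   neighbours, hence [N.+1]. *)
pose B0 := ball nb U N.+1.
have U_sub v : v \in U -> v \in B0 by move=> vU; apply: (ball_leq (k := 0%N)).
apply: (gibbs_patch_balanced bnb hs lam_gt0 Phom (B0 := B0)).
  move=> v; rewrite mem_uplus mem_bdry => /orP[/U_sub//|/andP[_ vB]].
  by apply: (ball_leq (k := 1%N)) => //=; rewrite mem_cat vB orbT.
move=> B B0B f g fh gh fg.
have UB : {subset U <= B} by move=> v /U_sub/B0B.
apply/(balance_weight _ _ UB fg).
pose E f g := pr P (cylset B f) * weight lam B g = pr P (cylset B g) * weight lam B f.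
apply: (agree_moves (E := E) bnb ctr _ _ _ fh gh fg) => //.
- move=> k1 k2 k3 e1 e2; rewrite /E.
  have k0 := weight_gt0 lam_gt0 B k2; apply: (mulIf (lt0r_neq0 k0)).
  by rewrite mulrAC e1 mulrAC e2 mulrAC.
move=> u k1 k2 uU h1 h2 k12.
have uB : u \in B by apply: B0B; apply: (ball_leq (k := N)).
have k12' v : v \notin [:: u] -> k1 v = k2 v by rewrite inE; apply: k12.
rewrite /E; apply/(balance_weight _ _ _ k12'); first by move=> v; rewrite inE => /eqP ->.
apply: (gibbs_patch_balance bnb hs lam_gt0 (os u)) => // v.
rewrite mem_uplus mem_bdry inE => /orP[/eqP ->//|/andP[_]] /=; rewrite cats0 => vu.
by apply: B0B; apply: ball_step uU.
Qed.

End OneSite.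

(** * The point process on a finite board *)

Section Chain.
Context {R : realType} {n : nat} {h : rel 'I_n.+1} (V : finType) (nb : V -> seq V)
  (lam : 'I_n.+1 -> R).
Hypotheses (bnb : board nb) (hs : symmetric h) (lam_gt0 : activity lam).
Local Notation config := {ffun V -> 'I_n.+1}.
Local Notation K := (pp_kernel nb h lam).

Definition site_step u (f g : V -> 'I_n.+1) : R :=
  if [forall v, (v != u) ==> (f v == g v)] && allowed nb h f u (g u)
  then lam (g u) / \sum_(k | allowed nb h f u k) lam k else 0.

Lemma pp_kernelE f g : K f g = \sum_u #|V|%:R^-1 * site_step u f g.
Proof. by []. Qed.

Lemma agreeP u (f g : V -> 'I_n.+1) :
  reflect (forall v, v != u -> f v = g v) [forall v, (v != u) ==> (f v == g v)].
Proof.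
apply: (iffP forallP) => H v; first by move=> vu; have := H v; rewrite vu => /eqP.
by apply/implyP => /H ->.
Qed.

Lemma allowed_agree u (f g : V -> 'I_n.+1) : (forall v, v != u -> f v = g v) ->
  allowed nb h f u =1 allowed nb h g u.
Proof.
move=> fg j; apply: eq_in_all => v vu; rewrite fg //.
by apply: contraTneq vu => ->; exact: bnb.2.
Qed.

Lemma allowed_hom f u : is_hom nb h f -> allowed nb h f u (f u).
Proof. by move=> fh; apply/allP => v vu; rewrite hs; apply: fh. Qed.

Lemma allowed_sum_gt0 f u : is_hom nb h f -> 0 < \sum_(k | allowed nb h f u k) lam k.
Proof.
move=> fh; rewrite (bigD1 (f u)) ?allowed_hom //=.
by apply: ltr_wpDr; [apply: sumr_ge0 => k _; apply/ltW/lam_gt0|apply: lam_gt0].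
Qed.

Lemma site_step_ge0 u f g : 0 <= site_step u f g.
Proof.
rewrite /site_step; case: ifP => // _; apply: divr_ge0; first exact/ltW/lam_gt0.
by apply: sumr_ge0 => k _; apply/ltW/lam_gt0.
Qed.

Lemma site_step_sum u f : is_hom nb h f -> \sum_(g : config) site_step u f g = 1.
Proof.
move=> fh; rewrite /site_step.
pose up j : config := [ffun v => if v == u then j else f v].
transitivity (\sum_(g : config | [forall v, (v != u) ==> (f v == g v)])
   if allowed nb h f u (g u) then lam (g u) / \sum_(k | allowed nb h f u k) lam k else 0).
  by rewrite [RHS]big_mkcond; apply: eq_bigr => g _; case: (agreeP u f g).
rewrite (reindex_onto up (fun g => g u)) /=; last first.
  move=> g /agreeP fg; apply/ffunP => v; rewrite ffunE; case: eqVneq => [->//|].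
  exact: fg.
rewrite (eq_bigl xpredT) => [|j]; last first.
  have -> : up j u = j by rewrite ffunE eqxx.
  by rewrite eqxx andbT; apply/agreeP => v /negbTE vu; rewrite ffunE vu.
rewrite (eq_bigr (fun j => if allowed nb h f u j
   then lam j / \sum_(k | allowed nb h f u k) lam k else 0)) => [|j _]; last by rewrite ffunE eqxx.
by rewrite -big_mkcond -mulr_suml divff // lt0r_neq0 ?allowed_sum_gt0.
Qed.

Lemma pp_kernel_sum f : (0 < #|V|)%N -> is_hom nb h f -> \sum_(g : config) K f g = 1.
Proof.
move=> V0 fh; under eq_bigr do rewrite pp_kernelE.
rewrite exchange_big /=; under eq_bigr => u _ do rewrite -mulr_sumr site_step_sum // mulr1.
by rewrite sumr_const -[_ *+ _]mulr_natl divff // pnatr_eq0 -lt0n.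
Qed.

Lemma pp_kernel_ge0 f g : 0 <= K f g.
Proof.
by rewrite pp_kernelE sumr_ge0 // => u _; rewrite mulr_ge0 ?invr_ge0 ?ler0n ?site_step_ge0.
Qed.

Lemma site_step_hom u f g : is_hom nb h f -> site_step u f g != 0 ->
  is_hom nb h g /\ forall v, v != u -> f v = g v.
Proof.
move=> fh; rewrite /site_step; case: ifP => [/andP[/agreeP fg /allP al] _|]; last by rewrite eqxx.
split=> // v w wv; have [vu|vu] := eqVneq v u; last first.
  have [wu|wu] := eqVneq w u; last by rewrite -!fg //; apply: fh.
  by rewrite wu -(fg _ vu); apply: al; rewrite -wu bnb.1.
have wu : w != u by apply: contraTneq wv => ->; rewrite vu; exact: bnb.2.
by rewrite vu hs -(fg _ wu); apply: al; rewrite -vu.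
Qed.

Lemma pp_kernel_hom f g : is_hom nb h f -> K f g != 0 -> is_hom nb h g.
Proof.
move=> fh; rewrite pp_kernelE => K0.
have [u u0|H] := pickP (fun u => site_step u f g != 0); first by have [] := site_step_hom fh u0.
move: K0; rewrite big1 ?eqxx // => u _.
by have /negbFE/eqP -> := H u; rewrite mulr0.
Qed.

(** The normalizing sum depends only on the configuration off [u], so it is common to both
    directions. The free coefficients [a], [b] allow both point masses and reversible weights. *)
Lemma site_step_balance u f g (a b : R) : is_hom nb h f -> is_hom nb h g ->
  ((forall v, v != u -> f v = g v) -> a * weight lam [:: u] g = b * weight lam [:: u] f) ->
  a * site_step u f g = b * site_step u g f.
Proof.
move=> fh gh ab; rewrite /site_step.
have w1 k : weight lam [:: u] k = lam (k u) by rewrite /weight /= big_seq1.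
case: (agreeP u f g) => [fg|nfg]; last first.
  case: (agreeP u g f) => [gf|_] /=; last by rewrite !mulr0.
  by case: nfg => v /gf.
have gf v : v != u -> g v = f v by move=> /fg.
have /agreeP -> := gf.
have -> : allowed nb h f u (g u) by rewrite (allowed_agree fg) allowed_hom.
have -> : allowed nb h g u (f u) by rewrite (allowed_agree gf) allowed_hom.
rewrite /= (eq_bigl _ _ (allowed_agree fg)) !mulrA; congr (_ / _).
by have := ab fg; rewrite !w1.
Qed.

Lemma pp_kernel_adj f g : (0 < #|V|)%N -> is_hom nb h f -> is_hom nb h g -> hom_adj f g ->
  0 < K f g.
Proof.
move=> V0 fh gh [u [_ fg]]; rewrite pp_kernelE (bigD1 u) //=.
have fg' v : v != u -> f v = g v by move=> /eqP/fg.
apply: ltr_wpDr.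
  by apply: sumr_ge0 => w _; rewrite mulr_ge0 ?invr_ge0 ?ler0n ?site_step_ge0.
rewrite mulr_gt0 ?invr_gt0 ?ltr0n // /site_step.
have /agreeP -> := fg'; rewrite (allowed_agree fg') allowed_hom //=.
by rewrite divr_gt0 ?lam_gt0 // allowed_sum_gt0.
Qed.

Variable P : probability (Omega V n) R.
Hypothesis Phom : P (homset nb h) = 1%E.
Local Notation pt f := (pr P (cylset (enum V) (f : V -> 'I_n.+1))).

Lemma point_cylset (f : V -> 'I_n.+1) (B : seq V) : {subset enum V <= B} ->
  [set f] = cylset B f :> set (Omega V n).
Proof.
move=> VB; apply/seteqP; split=> [g -> //|g gf].
by apply/funext => v; apply/gf/VB; rewrite mem_enum.
Qed.

Lemma point_mass (f : V -> 'I_n.+1) : P [set f] = (pt f)%:E.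
Proof. by rewrite (@point_cylset f (enum V)) // (prE P (cylset_measurable _ _)). Qed.

Lemma point_nonhom f : ~ is_hom nb h f -> pt f = 0.
Proof.
move=> nf; apply: (pr_nonhom Phom); first exact: cylset_measurable.
by rewrite -(@point_cylset f) // => _ ->.
Qed.

Lemma stationaryE : stationary nb h lam P <-> forall g : config, is_hom nb h g ->
  pt g = \sum_(f : config) pt f * K f g.
Proof.
have E (g : config) : (\sum_(f : config) P [set (fun v => f v)] * (K f g)%:E)%E =
    (\sum_(f : config) pt f * K f g)%:E.
  by rewrite -sumEFin; apply: eq_bigr => f _; rewrite EFinM point_mass.
split=> [[_ st] g gh|st]; last by split=> // g gh; rewrite E point_mass st.
by have := st g gh; rewrite E point_mass => -[].
Qed.

Lemma balanced_stationary : (0 < #|V|)%N ->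
  (forall u, balanced (h := h) nb lam P [:: u] (enum V)) -> stationary nb h lam P.
Proof.
move=> V0 bal; apply/stationaryE => g gh.
rewrite -[LHS]mulr1 -(pp_kernel_sum V0 gh) mulr_sumr; apply: eq_bigr => f _.
have [fh|nf] := pselect (is_hom nb h f); last first.
  rewrite (point_nonhom nf) mul0r; have [->|/(pp_kernel_hom gh)//] := eqVneq (K g f) 0.
  by rewrite mulr0.
rewrite !pp_kernelE !mulr_sumr; apply: eq_bigr => u _; rewrite !(mulrCA _ #|V|%:R^-1).
congr (_ * _); apply: site_step_balance => // gf.
by apply: (bal u) => // v; rewrite inE => /gf.
Qed.

(* The density of a stationary measure with respect to the reversible weight is
   harmonic, so it is constant on the connected graph [hom(G, H)]. *)
Lemma stationary_gibbs : (forall f g, is_hom nb h f -> is_hom nb h g -> hom_path nb h f g) ->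
  stationary nb h lam P -> gibbs nb h lam P.
Proof.
move=> conn /stationaryE st.
(* Without sites the kernel is an empty sum, but there is only one configuration. *)
have [V0|V0] := posnP #|V|.
  split=> // U; apply: (gibbs_patch_balanced bnb hs lam_gt0 Phom (B0 := uplus nb U)) => //.
  move=> B _ f g _ _ _; suff -> : f = g by [].
  by apply/funext => v; have := fintype0 v V0.
pose W f := weight lam (enum V) f.
have W0 f : 0 < W f by exact: weight_gt0.
pose x f := pt f / W f.
have rev (f g : config) : is_hom nb h f -> is_hom nb h g -> W f * K f g = W g * K g f.
  move=> fh gh; rewrite !pp_kernelE !mulr_sumr; apply: eq_bigr => u _.
  rewrite !(mulrCA _ #|V|%:R^-1); congr (_ * _); apply: site_step_balance => // fg.
  apply: weight_ratio; first by move=> v _; rewrite mem_enum.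
  by move=> v; rewrite inE => /fg.
have harm (g : config) : is_hom nb h g -> x g = \sum_(f : config) x f * K g f.
  move=> gh; rewrite /x [in LHS]st // mulr_suml; apply: eq_bigr => f _.
  have [fh|nf] := pselect (is_hom nb h f); last first.
    by rewrite (point_nonhom nf) !mul0r.
  have := rev f g fh gh; move: (W0 f) (W0 g) => f0 g0 e.
  apply: (mulIf (lt0r_neq0 g0)); rewrite mulfVK ?lt0r_neq0 //.
  by rewrite -!mulrA [K g f * _]mulrC -e !mulrA mulfVK ?lt0r_neq0.
suff const f g : is_hom nb h f -> is_hom nb h g -> x f = x g.
  split=> // U; apply: (gibbs_patch_balanced bnb hs lam_gt0 Phom (B0 := enum V ++ uplus nb U)).
    by move=> v vU; rewrite mem_cat vU orbT.
  move=> B VB f g fh gh fg.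
  have EB : {subset enum V <= B} by move=> v vV; apply: VB; rewrite mem_cat vV.
  have UV : {subset U <= enum V} by move=> v _; rewrite mem_enum.
  rewrite -!(point_cylset _ EB) !(@point_cylset _ (enum V)) //.
  apply/(balance_weight lam_gt0 _ _ UV fg); rewrite -/(W f) -/(W g).
  have := const f g fh gh; rewrite /x => /(congr1 (fun t => t * (W f * W g))).
  by rewrite mulrA mulfVK ?lt0r_neq0 // [W f * _]mulrC mulrA mulfVK ?lt0r_neq0.
pose fin (k : V -> 'I_n.+1) : config := [ffun v => k v].
have finE k : fin k = k :> (V -> 'I_n.+1) by apply/funext => v; rewrite ffunE.
move=> fh gh; pose homs (k : config) := `[< is_hom nb h k >].
have f0 : homs (fin f) by apply/asboolP; rewrite finE.
(* Maximum principle: where [x] is maximal, being an average forces equality at every configuration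
   reached with positive probability, hence all along a path. *)
case: (@arg_maxP _ _ _ (fin f) homs (fun k => x k) f0) => m /asboolP mh mmax.
suff xm k : is_hom nb h k -> x k = x m by rewrite !xm.
move=> kh; have mk := conn _ _ mh kh.
have {}mmax k' : is_hom nb h k' -> x k' <= x m.
  by move=> k'h; rewrite -(finE k'); apply: mmax; apply/asboolP; rewrite finE.
have prop a b : hom_path nb h a b -> x a = x m -> x b = x m.
  elim=> // {}a {}b c ab IH ch bc /IH xb {IH}.
  have bh := (hom_path_hom ab).2.
  have := harm (fin b); rewrite finE => /(_ bh) hb.
  have : \sum_(j : config) (x b - x j) * K (fin b) j = 0.
    under eq_bigr do rewrite mulrBl.
    by rewrite big_split /= sumrN -mulr_sumr pp_kernel_sum ?finE // mulr1 -hb subrr.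
  move/eqP; rewrite psumr_eq0 => [|j _]; last first.
    have [->|/pp_kernel_hom H] := eqVneq (K (fin b) j) 0; first by rewrite mulr0.
    by rewrite mulr_ge0 ?pp_kernel_ge0 // subr_ge0 xb; apply/mmax/H; rewrite finE.
  move/allP => /(_ (fin c)); rewrite mem_index_enum => /(_ isT); rewrite /= !finE.
  by rewrite mulf_eq0 (gt_eqF (pp_kernel_adj V0 bh ch bc)) orbF subr_eq0 => /eqP <-.
exact: prop mk erefl.
Qed.

End Chain.

(** * A measure on the double cover that is balanced at single sites only *)

Section Counterexample.
Context {R : realType} {n : nat} {h : rel 'I_n.+1}.
Variables (S : {set 'I_n.+1}) (rho : 'I_n.+1 -> 'I_n.+1).
Hypotheses (hs : symmetric h) (st : stiff_retract (h := h) S rho)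
  (h_edge : exists x y, h x y).
Local Notation V := (@dsite n).
Local Notation nb := (dnb (h := h) rho).
Local Notation phi := (dphi rho).
Local Notation one := (fun=> 1 : R).
Local Notation config := {ffun V -> 'I_n.+1}.

Lemma activity_one : activity (n := n) one.
Proof. by move=> i; apply: ltr01. Qed.

Lemma weight_one (U : seq V) (f : V -> 'I_n.+1) : weight one U f = 1.
Proof. by rewrite /weight big1. Qed.

(* The homs whose retraction is [phi] form a union of components of hom(G, H);
   the uniform measure on them is invariant under single-site updates. *)
Definition frozen_class (f : V -> 'I_n.+1) := is_hom nb h f /\ forall v, rho (f v) = phi v.

Lemma frozen_class_step u f g : is_hom nb h g -> (forall v, v != u -> f v = g v) ->
  frozen_class f -> frozen_class g.
Proof.
move=> gh fg [_ fr]; split=> // v.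
have fr' w : w != u -> rho (g w) = phi w by move=> /fg <-.
have [->|/fr'//] := eqVneq v u.
exact: (@dphi_rigid _ _ _ _ hs st g u gh fr').
Qed.

Lemma frozen_class_phi : frozen_class phi.
Proof.
split; first exact: dphi_hom.
by case: st => rS rid _ _ _ v; rewrite /dphi rid.
Qed.

Lemma component_measure : exists P : probability (Omega V n) R,
  [/\ P (homset nb h) = 1%E,
      (forall f, frozen_class f -> 0 < pr P (cylset (enum V) f)),
      (forall f, ~ frozen_class f -> pr P (cylset (enum V) f) = 0)
    & (forall u, balanced (h := h) nb one P [:: u] (enum V))].
Proof.
pose C := [set x : config | `[< frozen_class x >]]%SET.
pose fin (k : V -> 'I_n.+1) : config := [ffun v => k v].
have finE k : fin k = k :> (V -> 'I_n.+1) by apply/funext => v; rewrite ffunE.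
have C0 : (0 < #|C|%:R :> R).
  rewrite ltr0n; apply/card_gt0P; exists (fin phi); rewrite inE finE; apply/asboolP.
  exact: frozen_class_phi.
pose L (A : set (conf V n)) : R :=
  #|[set x in C | `[< A (fun v => x v) >]]%SET|%:R / #|C|%:R.
have LT : L setT = 1.
  rewrite /L (_ : [set x in C | _]%SET = C) ?divff ?lt0r_neq0 //.
  by apply/setP => x; rewrite inE; case: asboolP => [_|[]//]; rewrite andbT.
have L_ge0 A : 0 <= L A by rewrite divr_ge0.
have LU A B : A `&` B = set0 -> L (A `|` B) = L A + L B.
  move=> AB; rewrite /L -mulrDl -natrD; congr (_%:R / _).
  rewrite -cardsUI [X in (_ + X)%N](_ : _ = 0%N) ?addn0; last first.
    apply/eqP; rewrite cards_eq0; apply/eqP/setP => x; rewrite !inE.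
    apply/negbTE/negP => /andP[/andP[_ /asboolP Ax] /andP[_ /asboolP Bx]].
    by have : (A `&` B) (fun v => x v) by []; rewrite AB.
  apply: eq_card => x; rewrite !inE -andb_orr; congr (_ && _).
  apply/asboolP/orP => [[Ax|Bx]|[/asboolP Ax|/asboolP Bx]]; [left|right|left|right] => //;
    exact/asboolP.
have [P PL] := extension LT L_ge0 LU.
have ptE f : pr P (cylset (enum V) f) = (`[< frozen_class f >])%:R / #|C|%:R.
  rewrite PL /L -(@point_cylset _ _ f (enum V)) //; congr (_%:R / _).
  case: asboolP => [fC|nfC]; last first.
    apply/eqP; rewrite cards_eq0; apply/eqP/setP => x; rewrite !inE.
    by apply/negbTE/negP => /andP[/asboolP xC /asboolP xf]; apply: nfC; rewrite -xf.
  rewrite (_ : [set x in C | _]%SET = [set fin f]%SET) ?cards1 //.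
  apply/setP => x; rewrite !inE; apply/andP/eqP => [[_ /asboolP xf]|->].
    by apply/ffunP => v; rewrite ffunE -xf.
  by split; apply/asboolP; rewrite finE.
exists P; split.
- have mH : measurable (homset nb h : set (Omega V n)) by exact: homset_measurable.
  rewrite (prE P mH); congr (_%:E).
  pose T := enum V; pose Q (z : {ffun seq_sub T -> 'I_n.+1}) := `[< is_hom nb h (glue z (fun=> ord0)) >].
  have HQ : homset nb h = [set g : Omega V n | Q (res T g)].
    apply/seteqP; split=> g /=; rewrite /Q glue_res_id //; try (by move=> /asboolP); 
      try (by move=> gh; apply/asboolP); by move=> v; rewrite mem_enum.
  have L0 : L set0 = 0 by exact: L_set0.
  rewrite HQ (@pr_determined _ _ _ L P T Q L0 LU PL) -HQ -LT.
  rewrite /L; congr (_%:R / _); apply: eq_card => x; rewrite !inE.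
  case: (asboolP (frozen_class _)) => //= -[xh _].
  by apply/asboolP/asboolP.
- by move=> f fC; rewrite ptE; case: asboolP => // _; rewrite divr_gt0.
- by move=> f fC; rewrite ptE; case: asboolP => // _; rewrite mul0r.
move=> u f g fh gh fg; rewrite !weight_one !mulr1 !ptE; congr (_%:R / _).
have fg' v : v != u -> f v = g v by move=> vu; apply: fg; rewrite inE.
have gf' v : v != u -> g v = f v by move=> vu; rewrite fg'.
congr nat_of_bool; apply/asboolP/asboolP; [exact: frozen_class_step gh fg'|exact: frozen_class_step fh gf'].
Qed.

Lemma component_measure_not_gibbs (P : probability (Omega V n) R) :
  (forall f, frozen_class f -> 0 < pr P (cylset (enum V) f)) ->
  (forall f, ~ frozen_class f -> pr P (cylset (enum V) f) = 0) ->
  ~ gibbs nb h one P.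
Proof.
move=> Pp P0 [_ /(_ (enum V)) gp].
have VB : {subset uplus nb (enum V) <= enum V} by move=> v _; rewrite mem_enum.
have bal := gibbs_patch_balance (dnb_board rho hs) hs activity_one gp VB.
have [psi psih [v nv]] := dphi_other hs st h_edge.
have := bal phi psi (@dphi_hom _ _ rho) psih.
rewrite !weight_one !mulr1 (P0 psi) => [H|[_ /(_ v)]//].
have := Pp _ frozen_class_phi; rewrite H ?ltxx // => w.
by rewrite mem_enum.
Qed.

Lemma component_measure_one_site (P : probability (Omega V n) R) :
  P (homset nb h) = 1%E -> (forall u, balanced (h := h) nb one P [:: u] (enum V)) ->
  one_site nb h one P.
Proof.
move=> Phom bal u.
apply: (gibbs_patch_balanced (dnb_board rho hs) hs activity_one Phom (B0 := enum V)).
  by move=> v _; rewrite mem_enum.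
move=> B VB f g fh gh fg; rewrite -!(point_cylset _ VB) !(@point_cylset _ _ _ (enum V)) //.
exact: bal.
Qed.

End Counterexample.

Lemma one_site_dismantlable (R : realType) n (h : rel 'I_n.+1) : symmetric h ->
  (exists x y, h x y) ->
  (forall (V : countType) (nb : V -> seq V), board nb ->
     forall lam : 'I_n.+1 -> R, activity lam ->
     forall P : probability (Omega V n) R,
       P (homset nb h) = 1%E -> one_site nb h lam P -> gibbs nb h lam P) ->
  dismantlable h.
Proof.
move=> hs he os; apply: contrapT => nd.
have [S [rho st]] := stiff_retract_exists hs nd.
have [P [Phom Pp P0 bal]] := @component_measure R _ _ _ _ hs st.
apply: (component_measure_not_gibbs hs st he Pp P0).
apply: (os _ _ (dnb_board rho hs) _ activity_one) => //.
exact: component_measure_one_site.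
Qed.

Lemma stationary_dismantlable (R : realType) n (h : rel 'I_n.+1) : symmetric h ->
  (exists x y, h x y) ->
  (forall (V : finType) (nb : V -> seq V), board nb ->
     forall lam : 'I_n.+1 -> R, activity lam ->
     forall P : probability (Omega V n) R,
       stationary nb h lam P -> gibbs nb h lam P) ->
  dismantlable h.
Proof.
move=> hs he sg; apply: contrapT => nd.
have [S [rho st]] := stiff_retract_exists hs nd.
have [P [Phom Pp P0 bal]] := @component_measure R _ _ _ _ hs st.
apply: (component_measure_not_gibbs hs st he Pp P0).
apply: (sg _ _ (dnb_board rho hs) _ activity_one).
apply: (balanced_stationary (dnb_board rho hs) hs activity_one Phom) => //.
by apply/card_gt0P; exists (ord0, true).
Qed.

(** For any activities, frozen boundary conditions with root colours [a] and [b] yield Gibbs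
    measures that fix the retracted root colour almost surely. A unique measure would give
    probability 1 to two disjoint events. *)
Lemma tree_unique_dismantlable (R : realType) n (h : rel 'I_n.+1) : symmetric h ->
  (forall a, exists b, h a b) ->
  (forall r : nat, (0 < r)%N ->
     exists lam : 'I_n.+1 -> R, activity lam /\ unique_gibbs (@tnb r) h lam) ->
  dismantlable h.
Proof.
move=> hs nbr uniq; apply: contrapT => nd.
have [S [rho st]] := stiff_retract_exists hs nd.
case: (st) => _ _ _ _ [a [b [aS bS ab]]].
have [lam [lam0 [P0 [_ P0u]]]] := uniq n.*2.+1 isT.
pose root : tword n.*2.+1 := exist _ [::] isT.
pose A c := [set g : Omega (tword n.*2.+1) n | rho (g root) == c].
have mA c : measurable (A c).
  have uT : root \in [:: root] by rewrite inE eqxx.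
  have -> : A c = [set g | (fun z => rho (z (SeqSub uT)) == c) (res [:: root] g)].
    by apply/seteqP; split=> g; rewrite /A /= !ffunE.
  exact: (@measurable_res _ _ [:: root] (fun z => rho (z (SeqSub uT)) == c)).
have H c : c \in S -> pr P0 (A c) = 1.
  move=> cS; have [phi [ph pS proot cov]] := tree_covering st nbr hs cS.
  have [P [Pg Ps]] := gibbs_exists (tree_board _) hs lam0 ph.
  suff e : pr P (A c) = 1 by rewrite -e /pr -(P0u P Pg _ (mA c)).
  apply: (Ps root (fun i => rho i == c)) => k kh [s ks].
  by apply/eqP; rewrite -proot; exact: (tree_frozen st kh pS cov ks).
have : pr P0 (A a `|` A b) <= 1.
  by rewrite -(pr_setT P0); apply: pr_le => //; apply: measurableU.
rewrite pr_setU ?H //; first by lra.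
by apply/seteqP; split=> // g [/eqP ga /eqP gb]; move: ab; rewrite -ga gb eqxx.
Qed.

(** * Uniqueness of Gibbs measures *)

Section BallSize.
Context (V : countType) (nb : V -> seq V) (D : nat).
Hypothesis deg : forall v, (size (undup (nb v)) <= D)%N.
Local Open Scope nat_scope.

Lemma ball_size (S : seq V) k :
  size (undup (ball nb S k)) <= size (undup S) * D.+1 ^ k.
Proof.
elim: k => [|k IH]; first by rewrite muln1.
set b := ball nb S k in IH *.
pose b' := undup b ++ flatten [seq undup (nb v) | v <- undup b].
have sub : {subset undup (ball nb S k.+1) <= b'}.
  move=> v; rewrite mem_undup /= mem_cat [v \in b']mem_cat mem_undup -/b => /orP[->//|].
  case/flatten_mapP => u ub vu; apply/orP; right.
  by apply/flatten_mapP; exists u; rewrite mem_undup.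
apply: leq_trans (uniq_leq_size (undup_uniq _) sub) _.
rewrite size_cat expnS mulnCA mulSn leq_add // size_flatten /shape -map_comp.
apply: leq_trans (_ : size (undup b) * D <= _); last by rewrite mulnC leq_mul2l IH orbT.
elim: (undup b) => //= v s IHs; rewrite mulSn; apply: leq_add => //.
Qed.

(** Walks of k steps, listed without their starting site; their number is the entropy factor of the
    union bound. *)
Fixpoint walks k (u : V) : seq (seq V) := if k is k'.+1
  then flatten [seq [seq v :: p | p <- walks k' v] | v <- undup (nb u)] else [:: [::]].

Lemma walks_size k u : size (walks k u) <= D ^ k.
Proof.
elim: k u => [//|k IH] u /=; rewrite size_flatten /shape -map_comp expnS.
apply: leq_trans (_ : size (undup (nb u)) * D ^ k <= _); last by rewrite leq_mul2r deg orbT.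
elim: (undup (nb u)) => //= v s IHs; rewrite mulSn size_map.
exact: leq_add (IH v) IHs.
Qed.

Lemma walksP (e : rel V) u p : (forall v w, e v w -> w \in nb v) -> path e u p ->
  p \in walks (size p) u.
Proof.
move=> enb; elim: p u => [//|v p IH] u /= /andP[/enb vu /IH vp].
by apply/flatten_mapP; exists v; rewrite ?mem_undup // map_f.
Qed.

Lemma walks_ball k u p v : p \in walks k u -> v \in u :: p -> v \in ball nb [:: u] k.
Proof.
elim: k u p => [|k IH] u p /=; first by rewrite inE => /eqP ->.
case/flatten_mapP => w; rewrite mem_undup => wu /mapP [p' p'w ->].
rewrite in_cons => /predU1P [->|vp].
  by rewrite mem_cat (ball_leq (k := 0)) ?inE.
have := IH _ _ p'w vp.
suff H j x : x \in ball nb [:: w] j -> x \in ball nb [:: u] j.+1 by apply: H.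
elim: j x => [|j IHj] x; first by rewrite /= inE => /eqP ->; rewrite !inE cats0 wu orbT.
rewrite [ball _ _ j.+1]/= mem_cat => /orP[/IHj|/flatten_mapP [y /IHj yb xy]].
  exact: ball_leq (leqnSn j.+1).
exact: ball_step xy yb.
Qed.

Lemma ball_sub (S T : seq V) k : {subset S <= T} -> {subset ball nb S k <= ball nb T k}.
Proof.
move=> ST; elim: k => //= k IH v; rewrite !mem_cat => /orP[/IH ->//|].
by case/flatten_mapP => u /IH ub vu; apply/orP; right; apply/flatten_mapP; exists u.
Qed.

Lemma ball_ball (S : seq V) j k : ball nb (ball nb S j) k = ball nb S (j + k).
Proof. by elim: k => [|k IH] /=; rewrite ?addn0 // addnS /= IH. Qed.

End BallSize.

(** * Peierls estimate and exchange of clusters *)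

Section Peierls.
Context {R : realType} {n : nat} {h : rel 'I_n.+1} (V : countType) (nb : V -> seq V).
Variables (N : nat) (rho : nat -> 'I_n.+1 -> 'I_n.+1) (x0 : 'I_n.+1) (rk : 'I_n.+1 -> nat).
Variables (D Lam : nat).
Hypotheses (bnb : board nb) (ctr : collapse (h := h) N rho x0 rk)
  (deg : forall v, (size (undup (nb v)) <= D)%N) (Lam_gt0 : (0 < Lam)%N).

(** The weight is then [Lam] to the total rank, so each site moved by a retraction gains at least a
    factor [Lam]. *)
Definition rank_activity (i : 'I_n.+1) : R := (Lam ^ rk i)%:R.
Local Notation lam := rank_activity.

Lemma rank_activity_gt0 : activity lam.
Proof. by move=> i; rewrite ltr0n expn_gt0 Lam_gt0. Qed.

Lemma weight_rank (B : seq V) (f : V -> 'I_n.+1) :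
  weight lam B f = (Lam ^ (\sum_(v <- undup B) rk (f v)))%:R.
Proof. by rewrite expn_sum natr_prod. Qed.

Variable B : seq V.
Local Notation conf_in := {ffun seq_sub B -> 'I_n.+1}.

Definition hom_weight (t : V -> 'I_n.+1) (x : conf_in) : R :=
  if `[< is_hom nb h (glue x t) >] then weight lam B (glue x t) else 0.

Lemma hom_weight_ge0 t x : 0 <= hom_weight t x.
Proof. by rewrite /hom_weight; case: ifP => // _; apply/ltW/weight_gt0/rank_activity_gt0. Qed.

Lemma hom_weight_sum t : \sum_x hom_weight t x = pfun (h := h) nb lam B t.
Proof. by rewrite /pfun [RHS]big_mkcond. Qed.

Lemma mass_hom_weight t A : mass (h := h) nb lam t B A =
  \sum_x hom_weight t x * (`[< A (glue x t) >])%:R.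
Proof.
rewrite /mass big_mkcond; apply: eq_bigr => x _; rewrite /hom_weight asbool_and.
by case: `[< is_hom _ _ _ >] => /=; case: `[< A _ >]; rewrite ?mulr1 ?mulr0 ?mul0r.
Qed.

(** [p] is a pair of configurations with boundary conditions [t] and [t'], weighted by the product;
    off the excited sites they agree, both being [x0]. *)
Definition excited (t t' : V -> 'I_n.+1) (p : conf_in * conf_in) : pred V :=
  fun v => (glue p.1 t v != x0) || (glue p.2 t' v != x0).

Section Fold.
Variable S : seq V.
Hypotheses (uS : uniq S) (SB : {subset ball nb S N <= B}).

Definition fold_conf t (x : conf_in) : conf_in := res B (shift rho (blev nb S N) (glue x t)).

Lemma glue_fold t x : glue (fold_conf t x) t = shift rho (blev nb S N) (glue x t).
Proof.
apply: glue_res_id => v vB; rewrite /shift blev_out ?glue_out //; last by apply: contra vB => /SB.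
by case: ctr => -> //; rewrite inE.
Qed.

Lemma fold_conf_hom t x : is_hom nb h (glue x t) -> is_hom nb h (glue (fold_conf t x) t).
Proof. by rewrite glue_fold; apply: (shift_hom bnb ctr); apply: blev_lip. Qed.

Lemma fold_rank t x v :
  (rk (glue x t v) + ((v \in S) && (glue x t v != x0)) <= rk (glue (fold_conf t x) t v))%N.
Proof.
rewrite glue_fold /shift; case: ctr => _ _ rN _ rrk.
have {}rrk s a : rho s a = a \/ (rk a < rk (rho s a))%N by apply: rrk; rewrite inE.
have rk_le s a : (rk a <= rk (rho s a))%N by case: (rrk s a) => [->|/ltnW].
have [vS|vS] /= := boolP (v \in S); last by rewrite addn0.
case: eqVneq => [e|ne] /=; first by rewrite addn0.
rewrite addn1; case: (rrk (blev nb S N v) (glue x t v)) => //.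
by rewrite blev_in // rN ?inE // => e; rewrite e eqxx in ne.
Qed.

(** Each site of [S] differs from [x0] in at least one of the two configurations, so their total
    rank rises by at least [size S]. *)
Lemma fold_weight t t' p : (forall v, v \in S -> excited t t' p v) ->
  (Lam ^ size S)%:R * (hom_weight t p.1 * hom_weight t' p.2) <=
  hom_weight t (fold_conf t p.1) * hom_weight t' (fold_conf t' p.2).
Proof.
move=> ex; rewrite {1 2}/hom_weight.
case: asboolP => [xh|_]; last by rewrite mul0r mulr0 mulr_ge0 ?hom_weight_ge0.
case: asboolP => [yh|_]; last by rewrite !mulr0 mulr_ge0 ?hom_weight_ge0.
rewrite /hom_weight !asboolT; try exact: fold_conf_hom.
rewrite !weight_rank -!natrM ler_nat -!expnD leq_pexp2l //.
rewrite -!big_split /=.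
have -> : size S = (\sum_(v <- undup B) (v \in S))%N.
  transitivity (size [seq v <- undup B | v \in S]).
    apply/perm_size/uniq_perm; rewrite ?filter_uniq ?undup_uniq // => v.
    rewrite mem_filter mem_undup /=; case vS: (v \in S) => //=.
    by symmetry; apply: SB; apply: (ball_leq (k := 0%N)).
  by rewrite size_filter -sum1_count big_mkcond; apply: eq_bigr => v _; rewrite /=; case: (v \in S).
rewrite -big_split /=; apply: leq_sum => v _.
apply: leq_trans (leq_add (fold_rank t p.1 v) (fold_rank t' p.2 v)).
rewrite addnACA addnC leq_add2l; case vS: (v \in S) => //=.
by have := ex v vS; rewrite /excited; case: (_ != x0) => //= ->.
Qed.

(** The level vanishes off the ball of radius [N] around [S], so a configuration is recovered from
    its fold and its values on that ball. *)
Lemma fold_fiber t x' :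
  (#|[set x : conf_in | fold_conf t x == x']%SET| <= n.+1 ^ (size S * D.+1 ^ N))%N.
Proof.
pose T := undup (ball nb S N).
have inj : {in [set x : conf_in | fold_conf t x == x']%SET &,
    injective (fun x => res T (glue x t))}.
  move=> x y; rewrite !inE => /eqP xe /eqP ye /eqP/resP xy.
  rewrite -(res_glue x t) -(res_glue y t); apply/eqP/resP => v vB.
  have [vT|vT] := boolP (v \in T); first exact: xy.
  have lv : blev nb S N v = 0%N by apply: blev_out; rewrite -mem_undup.
  have := congr1 (fun k => glue k t v) (etrans xe (esym ye)).
  by rewrite /= !glue_fold /shift lv; case: ctr => r0 _ _ _ _; rewrite !r0 ?inE.
rewrite -(card_in_imset inj); apply: leq_trans (max_card _) _.
rewrite card_ffun card_ord card_seq_sub ?undup_uniq // leq_pexp2l //.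
by apply: leq_trans (ball_size deg S N) _; rewrite undup_id.
Qed.

Lemma fold_sum t : \sum_x hom_weight t (fold_conf t x) <=
  (n.+1 ^ (size S * D.+1 ^ N))%:R * pfun (h := h) nb lam B t.
Proof.
rewrite (partition_big (fold_conf t) xpredT) //= -hom_weight_sum mulr_sumr.
apply: ler_sum => x' _; rewrite (eq_bigr (fun=> hom_weight t x')) => [|x /eqP -> //].
rewrite sumr_const -[_ *+ _]mulr_natl ler_wpM2r ?hom_weight_ge0 // ler_nat.
by apply: leq_trans (fold_fiber t x'); rewrite cardsE.
Qed.

(* Peierls estimate: [fold_conf], applied to both configurations, multiplies the
   weight by at least [Lam ^ size S] and has fibers of cardinal at most
   [(n.+1 ^ (2 * D.+1 ^ N)) ^ size S]. *)
Lemma excited_sum t t' :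
  (Lam ^ size S)%:R * \sum_(p : conf_in * conf_in | all (excited t t' p) S)
     hom_weight t p.1 * hom_weight t' p.2 <=
  ((n.+1 ^ (2 * D.+1 ^ N)) ^ size S)%:R *
    (pfun (h := h) nb lam B t * pfun (h := h) nb lam B t').
Proof.
rewrite mulr_sumr.
apply: (@le_trans _ _ (\sum_(p : conf_in * conf_in)
   hom_weight t (fold_conf t p.1) * hom_weight t' (fold_conf t' p.2))).
  rewrite big_mkcond; apply: ler_sum => p _; case: allP => [ex|_].
    exact: fold_weight.
  by rewrite mulr_ge0 ?hom_weight_ge0.
rewrite -(pair_big xpredT xpredT (fun x y => hom_weight t (fold_conf t x) *
   hom_weight t' (fold_conf t' y))) /= -big_distrlr /=.
have -> : ((n.+1 ^ (2 * D.+1 ^ N)) ^ size S)%:R * (pfun (h := h) nb lam B t * pfun (h := h) nb lam B t')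
  = ((n.+1 ^ (size S * D.+1 ^ N))%:R * pfun (h := h) nb lam B t) *
    ((n.+1 ^ (size S * D.+1 ^ N))%:R * pfun (h := h) nb lam B t').
  rewrite mulrACA -natrM -expnD -expnM; congr (_%:R * _); congr (_ ^ _)%N; lia.
by apply: ler_pM; rewrite ?fold_sum // sumr_ge0 // => x _; apply: hom_weight_ge0.
Qed.

End Fold.

Section Swap.
Variables (t t' : V -> 'I_n.+1) (U : seq V) (M : nat).
Hypothesis UB : {subset ball nb U (M + N) <= B}.

Definition ex_edge p : rel V := fun u v => (v \in nb u) && excited t t' p v.

Definition cluster p : pred V := fun v => `[< exists u q,
  [/\ u \in U, excited t t' p u, path (ex_edge p) u q & last u q = v] >].

Definition percolates p : bool := `[< exists u q, [/\ u \in U, excited t t' p u,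
  path (ex_edge p) u q, uniq (u :: q) & size q = M] >].

Lemma cluster_step p u v : cluster p u -> v \in nb u -> excited t t' p v -> cluster p v.
Proof.
move=> /asboolP [w [q [wU wx wq <-]]] vu vx; apply/asboolP.
exists w, (rcons q v); split=> //; last by rewrite last_rcons.
by rewrite rcons_path wq /ex_edge vu vx.
Qed.

Lemma cluster_ball p v : ~~ percolates p -> cluster p v -> v \in B.
Proof.
move=> np /asboolP [u [q [uU ux uq <-]]]; case/shortenP: uq => q' uq' uniq_q' _.
have enb w1 w2 : ex_edge p w1 w2 -> w2 \in nb w1 by move=> /andP[].
(* A simple excited path with at least [M] steps, once truncated, would witness percolation. *)
have [qM|Mq] := ltnP (size q') M; last first.
  case/negP: np; apply/asboolP; exists u, (take M q'); split => //.
  - exact: take_path.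
  - by move: uniq_q' => /= /andP[uN uq]; rewrite take_uniq // andbT; apply: contra uN => /mem_take.
  - exact: size_takel.
apply: UB; have := walks_ball (walksP enb uq') (mem_last u q').
move=> /(ball_leq (k' := (M + N)%N)) H; apply: (@ball_sub _ _ [:: u]).
  by move=> w; rewrite inE => /eqP ->.
by apply: H; apply: leq_trans (ltnW qM) (leq_addr _ _).
Qed.

Definition swap p : conf_in * conf_in :=
  (res B (fun v => if cluster p v then glue p.2 t' v else glue p.1 t v),
   res B (fun v => if cluster p v then glue p.1 t v else glue p.2 t' v)).

(** Without percolation the cluster stays inside [B], so the exchange leaves both boundary
    conditions in place. *)
Lemma glue_swap p : ~~ percolates p ->
  glue (swap p).1 t = (fun v => if cluster p v then glue p.2 t' v else glue p.1 t v) /\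
  glue (swap p).2 t' = (fun v => if cluster p v then glue p.1 t v else glue p.2 t' v).
Proof.
move=> np; split; apply: glue_res_id => v vB; (case: ifPn => [/(cluster_ball np) vB'|_];
  [by rewrite vB' in vB|exact: glue_out]).
Qed.

Lemma excited_swap p : ~~ percolates p -> excited t t' (swap p) = excited t t' p.
Proof.
move=> np; have [e1 e2] := glue_swap np; apply/funext => v.
by rewrite /excited e1 e2; case: (cluster p v) => //; rewrite orbC.
Qed.

Lemma percolates_swap p : ~~ percolates p -> percolates (swap p) = percolates p.
Proof. by move=> np; rewrite /percolates /ex_edge excited_swap. Qed.

Lemma swapK p : ~~ percolates p -> swap (swap p) = p.
Proof.
move=> np; have [e1 e2] := glue_swap np.
have ce : cluster (swap p) = cluster p by rewrite /cluster /ex_edge excited_swap.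
have s1 : (swap (swap p)).1 = p.1.
  rewrite -[RHS](res_glue p.1 t).
  transitivity (res B (fun v => if cluster (swap p) v then glue (swap p).2 t' v
    else glue (swap p).1 t v)) => //.
  by congr res; apply/funext => v; rewrite ce e1 e2; case: (cluster p v).
have s2 : (swap (swap p)).2 = p.2.
  rewrite -[RHS](res_glue p.2 t').
  transitivity (res B (fun v => if cluster (swap p) v then glue (swap p).1 t v
    else glue (swap p).2 t' v)) => //.
  by congr res; apply/funext => v; rewrite ce e1 e2; case: (cluster p v).
by rewrite [LHS]surjective_pairing s1 s2 -surjective_pairing.
Qed.

(** An edge leaving the cluster ends at a site where both configurations are [x0], so it is an edge
    of either configuration. *)
Lemma swap_hom p : ~~ percolates p -> is_hom nb h (glue p.1 t) -> is_hom nb h (glue p.2 t') ->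
  is_hom nb h (glue (swap p).1 t) /\ is_hom nb h (glue (swap p).2 t').
Proof.
move=> np h1 h2; have [-> ->] := glue_swap np.
have calm v : ~~ excited t t' p v -> glue p.1 t v = x0 /\ glue p.2 t' v = x0.
  by rewrite /excited negb_or !negbK => /andP[/eqP -> /eqP ->].
have edge u v : v \in nb u -> cluster p u -> ~~ cluster p v ->
    glue p.1 t v = glue p.2 t' v.
  move=> vu cu; have [vx|/calm[-> -> //]] := boolP (excited t t' p v).
  by rewrite (cluster_step cu vu vx).
by split=> u v vu; have uv : u \in nb v by [rewrite bnb.1];
  case: ifPn => cu; case: ifPn => cv; try (by apply: h1); try (by apply: h2);
  [rewrite (edge u v) //; exact: h2|rewrite (edge v u) //; exact: h2
  |rewrite -(edge u v) //; exact: h1|rewrite -(edge v u) //; exact: h1].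
Qed.

Lemma swap_weight p : ~~ percolates p ->
  hom_weight t (swap p).1 * hom_weight t' (swap p).2 = hom_weight t p.1 * hom_weight t' p.2.
Proof.
move=> np.
have H q : ~~ percolates q -> is_hom nb h (glue q.1 t) -> is_hom nb h (glue q.2 t') ->
    hom_weight t (swap q).1 * hom_weight t' (swap q).2 = hom_weight t q.1 * hom_weight t' q.2.
  move=> nq h1 h2; have [s1 s2] := swap_hom nq h1 h2.
  rewrite /hom_weight !asboolT // /weight -!big_split /=; apply: eq_bigr => v _.
  by have [-> ->] := glue_swap nq; case: ifP => // _; rewrite mulrC.
have zero q : ~ (is_hom nb h (glue q.1 t) /\ is_hom nb h (glue q.2 t')) ->
    hom_weight t q.1 * hom_weight t' q.2 = 0.
  move=> nh; rewrite /hom_weight; do 2?case: asboolP; rewrite ?mul0r ?mulr0 //.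
  by move=> h2 h1; case: nh.
have [[h1 h2]|nh] := pselect (is_hom nb h (glue p.1 t) /\ is_hom nb h (glue p.2 t')).
  exact: H.
rewrite (zero p) //; have [[s1 s2]|ns] := pselect (is_hom nb h (glue (swap p).1 t) /\
   is_hom nb h (glue (swap p).2 t')); last exact: zero.
by rewrite -H ?percolates_swap // swapK // zero.
Qed.

(** On [U] the exchange is complete: a site of [U] off the cluster is not excited, so the
    configurations already agree there. *)
Lemma swap_cylset p a : ~~ percolates p ->
  cylset U a (glue (swap p).1 t) <-> cylset U a (glue p.2 t').
Proof.
move=> np; have [-> _] := glue_swap np.
have E v : v \in U -> (if cluster p v then glue p.2 t' v else glue p.1 t v) = glue p.2 t' v.
  move=> vU; case: ifPn => // nc.
  have : ~~ excited t t' p v.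
    by apply: contra nc => vx; apply/asboolP; exists v, [::].
  by rewrite /excited negb_or !negbK => /andP[/eqP -> /eqP ->].
by split=> H v vU; [rewrite -E|rewrite E]; rewrite ?H.
Qed.

(** Union bound over walks of [M] steps from [U], with [excited_sum] applied to the M+1 sites of
    each. The margin [N] in [UB] makes room for folding around the whole walk. *)
Lemma percolation_sum :
  (Lam ^ M.+1)%:R * \sum_(p : conf_in * conf_in | percolates p)
     hom_weight t p.1 * hom_weight t' p.2 <=
  (size U * D ^ M * (n.+1 ^ (2 * D.+1 ^ N)) ^ M.+1)%:R *
    (pfun (h := h) nb lam B t * pfun (h := h) nb lam B t').
Proof.
pose W (p : conf_in * conf_in) := hom_weight t p.1 * hom_weight t' p.2.
have W0 p : 0 <= W p by rewrite mulr_ge0 ?hom_weight_ge0.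
pose Z := pfun (h := h) nb lam B t * pfun (h := h) nb lam B t'.
have Z0 : 0 <= Z by rewrite /Z -!hom_weight_sum mulr_ge0 // sumr_ge0 // => x _; apply: hom_weight_ge0.
pose I := (n.+1 ^ (2 * D.+1 ^ N))%N.
have per_walk u q : u \in U -> q \in walks nb M u ->
    (Lam ^ M.+1)%:R * \sum_(p | uniq (u :: q) && all (excited t t' p) (u :: q)) W p <=
    (I ^ M.+1)%:R * Z.
  move=> uU qM; have sq : size q = M.
    elim: (M) (u) (q) qM => [|k IH] w r /=; first by rewrite inE => /eqP ->.
    by case/flatten_mapP => w' _ /mapP [r' /IH sr ->] /=; rewrite sr.
  have [uq|_] := boolP (uniq (u :: q)); last by rewrite big_pred0 // mulr0 mulr_ge0.
  have SB : {subset ball nb (u :: q) N <= B}.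
    move=> v vb; apply: UB; rewrite -ball_ball; apply: ball_sub vb => w wq.
    apply: (@ball_sub _ _ [:: u]); first by move=> w'; rewrite inE => /eqP ->.
    exact: walks_ball qM wq.
  by have := excited_sum uq SB t t'; rewrite /= sq.
have union p : (percolates p)%:R <= \sum_(u <- U) \sum_(q <- walks nb M u)
    (uniq (u :: q) && all (excited t t' p) (u :: q))%:R :> R.
  case: (boolP (percolates p)) => [/asboolP [u [q [uU ux uq qu sq]]]|_]; last first.
    by apply: sumr_ge0 => u _; apply: sumr_ge0.
  have qw : q \in walks nb M u by rewrite -sq; apply: (walksP _ uq) => v w /andP[].
  have allx : all (excited t t' p) (u :: q).
    rewrite /= ux /=; elim: q u {uU ux qu sq qw} uq => //= v q IH u /andP[/andP[_ ->] /IH].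
    by [].
  rewrite (perm_big _ (perm_to_rem uU)) big_cons (perm_big _ (perm_to_rem qw)) big_cons.
  rewrite qu allx /= -addrA ler_wpDr // addr_ge0 //.
    exact: sumr_ge0.
  by apply: sumr_ge0 => u' _; apply: sumr_ge0.
apply: (@le_trans _ _ ((Lam ^ M.+1)%:R * \sum_(u <- U) \sum_(q <- walks nb M u)
    \sum_(p | uniq (u :: q) && all (excited t t' p) (u :: q)) W p)).
  rewrite ler_pM2l ?ltr0n ?expn_gt0 ?Lam_gt0 //.
  under [leRHS]eq_bigr do under eq_bigr do rewrite big_mkcond.
  under [leRHS]eq_bigr do rewrite exchange_big.
  rewrite exchange_big big_mkcond; apply: ler_sum => p _.
  apply: (@le_trans _ _ (W p * (percolates p)%:R)).
    by rewrite /W; case: (percolates p); rewrite ?mulr1 ?mulr0.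
  apply: (le_trans (ler_wpM2l (W0 p) (union p))).
  rewrite mulr_sumr; apply: ler_sum => u _; rewrite mulr_sumr; apply: ler_sum => q _.
  by case: (_ && _); rewrite ?mulr1 ?mulr0.
rewrite -/I -/Z mulr_sumr big_seq.
apply: (@le_trans _ _ (\sum_(u <- U | u \in U) (D ^ M)%:R * ((I ^ M.+1)%:R * Z))).
  apply: ler_sum => u uU; rewrite mulr_sumr.
  apply: (@le_trans _ _ (\sum_(q <- walks nb M u) (I ^ M.+1)%:R * Z)).
    by rewrite big_seq [leRHS]big_seq; apply: ler_sum => q; apply: per_walk.
  rewrite big_const_seq count_predT iter_addr_0 -[leLHS]mulr_natl.
  apply: ler_wpM2r; first by rewrite mulr_ge0.
  by rewrite ler_nat; apply: walks_size.
rewrite -big_seq big_const_seq count_predT iter_addr_0 -[leLHS]mulr_natl.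
by rewrite !natrM !mulrA.
Qed.

(* [swap] exchanges the two terms on the pairs that do not percolate. *)
Lemma mass_compare a :
  mass (h := h) nb lam t B (cylset U a) * pfun (h := h) nb lam B t' <=
  pfun (h := h) nb lam B t * mass (h := h) nb lam t' B (cylset U a) +
  \sum_(p : conf_in * conf_in | percolates p) hom_weight t p.1 * hom_weight t' p.2.
Proof.
rewrite !mass_hom_weight -!hom_weight_sum !big_distrlr /= !pair_bigA /=.
pose F (p : conf_in * conf_in) :=
  hom_weight t p.1 * (`[< cylset U a (glue p.1 t) >])%:R * hom_weight t' p.2.
pose G (p : conf_in * conf_in) :=
  hom_weight t p.1 * (hom_weight t' p.2 * (`[< cylset U a (glue p.2 t') >])%:R).
have FW p : F p <= hom_weight t p.1 * hom_weight t' p.2.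
  rewrite /F; case: `[< _ >]; rewrite ?mulr1 // mulr0 mul0r mulr_ge0 ?hom_weight_ge0 //.
have G0 p : 0 <= G p by rewrite !mulr_ge0 ?hom_weight_ge0.
rewrite -[X in X <= _]/(\sum_p F p) -[X in _ <= X + _]/(\sum_p G p).
rewrite (bigID percolates) [X in _ <= X + _](bigID percolates) /=.
have -> : \sum_(p | ~~ percolates p) F p = \sum_(p | ~~ percolates p) G p.
  rewrite (reindex_onto swap swap) /=; last by move=> p; apply: swapK.
  apply: eq_big => [p|p /andP[np1 /eqP pp]].
    apply/andP/idP => [[np /eqP pp]|np]; last by rewrite percolates_swap // np swapK.
    by rewrite -pp percolates_swap.
  have np : ~~ percolates p by rewrite -pp percolates_swap.
  rewrite /F /G mulrAC swap_weight // mulrA; congr (_ * _%:R); congr nat_of_bool.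
  by apply/asboolP/asboolP => /(swap_cylset a np).
rewrite addrC -addrA [leRHS]addrCA; apply: lerD => //.
by apply: ler_wpDl; [apply: sumr_ge0|apply: ler_sum].
Qed.

End Swap.
End Peierls.

(** * Gibbs measures as mixtures of finite-volume measures *)

Section Mixture.
Context {R : realType} {n : nat} {h : rel 'I_n.+1} (V : countType) (nb : V -> seq V)
  (lam : 'I_n.+1 -> R).
Hypotheses (bnb : board nb) (hs : symmetric h) (lam_gt0 : activity lam).
Variable P : probability (Omega V n) R.
Hypothesis Pgibbs : gibbs nb h lam P.

Lemma gibbs_finite_volume (U B : seq V) (a t : V -> 'I_n.+1) : {subset U <= B} ->
  is_hom nb h t ->
  pr P (cylset U a `&` cylset (outside B (uplus nb B)) t) * pfun (h := h) nb lam B t =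
  pr P (cylset (outside B (uplus nb B)) t) * mass (h := h) nb lam t B (cylset U a).
Proof.
move=> UB th; have [Phom gp] := Pgibbs.
set B' := uplus nb B; set T := outside B B'.
have BB' : {subset B <= B'} by move=> v; apply: uplus_sub.
have mA := cylset_measurable U a; have mT := cylset_measurable T t.
have bal := gibbs_patch_balance bnb hs lam_gt0 (gp B) (B := B') (fun v => id).
rewrite (pr_partition P B (measurableI _ _ mA mT)) mulr_suml /mass mulr_sumr.
rewrite [RHS]big_mkcond; apply: eq_bigr => x _.
rewrite -setIA glue_cylset // asbool_and.
have Bx v : v \in U -> v \in B' by move=> /UB/BB'.
case: (asboolP (cylset U a (glue x t))) => [xa|nxa]; last first.
  rewrite andbF (_ : _ `&` _ = set0) ?pr_set0 ?mul0r //.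
  apply/seteqP; split=> // g [ga gx]; apply: nxa => v vU.
  by rewrite -gx ?ga //; apply: Bx.
rewrite andbT setIC (setIidl (B := cylset U a)); last first.
  by move=> g gx v vU; rewrite gx ?xa //; apply: Bx.
have xt v : v \notin B -> glue x t v = t v by move=> vB; rewrite glue_out.
case: asboolP => [xh|nh]; last by have [-> _] := nonhom_null lam bnb hs Phom (fun v => id) th xt nh; rewrite mul0r.
rewrite -(pfun_ext _ _ xt) (balanced_sum bnb hs Phom bal (fun v => id) xh).
congr (pr _ _ * _); apply: cylset_ext => v; rewrite mem_outside => /andP[/xt] //.
Qed.

(** Split according to the values on the boundary of [B]: values that no hom extends have
    probability 0, and a bound uniform in the others passes to the average. *)
Lemma gibbs_sandwich (U B : seq V) (a : V -> 'I_n.+1) (c d : R) : {subset U <= B} -> 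
  (forall t, is_hom nb h t -> c * pfun (h := h) nb lam B t <=
     mass (h := h) nb lam t B (cylset U a) <= d * pfun (h := h) nb lam B t) ->
  c <= pr P (cylset U a) <= d.
Proof.
move=> UB cd; have [Phom gp] := Pgibbs.
set T := outside B (uplus nb B).
have mA := cylset_measurable U a.
have tot : 1 = \sum_(z : {ffun seq_sub T -> 'I_n.+1}) pr P (cylset T (glue z (fun=> ord0))).
  rewrite -(pr_setT P) (pr_partition P T measurableT).
  by apply: eq_bigr => z _; rewrite setTI.
suff term z : c * pr P (cylset T z) <= pr P (cylset U a `&` cylset T z) <= d * pr P (cylset T z).
  rewrite (pr_partition P T mA) -[c]mulr1 -[d]mulr1 tot !mulr_sumr.
  by apply/andP; split; apply: ler_sum => z _; have /andP[] := term (glue z (fun=> ord0)).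
have mT := cylset_measurable T z.
have [[t [th tz]]|ne] := pselect (exists t, is_hom nb h t /\ cylset T z t); last first.
  have p0 : pr P (cylset T z) = 0.
    by apply: (pr_nonhom Phom) => // k kz kh; apply: ne; exists k.
  rewrite p0 !mulr0 pr_ge0 /= -p0; apply: pr_le => //; exact: measurableI.
have -> : cylset T z = cylset T t by apply: cylset_ext => v /tz.
have Z0 := pfun_gt0 lam_gt0 B th.
rewrite -(ler_pM2r Z0) -[X in _ && X](ler_pM2r Z0) gibbs_finite_volume // -/T.
have /andP[cm md] := cd t th.
by rewrite [c * _]mulrC [d * _]mulrC -!mulrA; apply/andP; split; apply: ler_wpM2l; rewrite ?pr_ge0.
Qed.

End Mixture.

Lemma gibbs_eq (R : realType) n (V : countType) (P Q : probability (Omega V n) R) :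
  (forall U a, pr P (cylset U a) = pr Q (cylset U a)) ->
  forall A, measurable A -> Q A = P A.
Proof.
move=> PQ A mA; apply: (@cyl_measure_unique V n R [::] Q P) => //.
- by apply: le_lt_trans (probability_le1 Q measurableT) _; rewrite ltry.
- move=> B f _; have mB := cylset_measurable B f.
  transitivity (pr Q (cylset B f))%:E; first exact: prE.
  by rewrite -PQ; symmetry; exact: prE.
by rewrite cyl_out_nil.
Qed.

Lemma eq0_geometric (R : realType) (x : R) k : 0 <= x ->
  (forall M, x * (2 ^ M)%:R <= k%:R) -> x = 0.
Proof.
move=> x0 H; apply/eqP; rewrite eq_le x0 andbT leNgt; apply/negP => xp.
have := H (Num.bound (k%:R / x)); rewrite leNgt => /negP; apply.
rewrite -ltr_pdivrMl // mulrC.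
apply: lt_le_trans (archi_boundP _) _; first by rewrite divr_ge0.
by rewrite ler_nat; apply: ltnW; apply: ltn_expl.
Qed.

(** Finite-volume probabilities for two boundary conditions differ by at most [del M], so any two
    Gibbs measures lie in the same band around the one for [f0], whose width tends to 0. *)
Lemma collapse_unique_gibbs (R : realType) n (h : rel 'I_n.+1) N rho x0 rk
    (V : countType) (nb : V -> seq V) : collapse (h := h) N rho x0 rk -> symmetric h ->
  board nb -> (exists D : nat, forall v, (size (undup (nb v)) <= D)%N) ->
  (exists f : V -> 'I_n.+1, is_hom nb h f) ->
  exists lam : 'I_n.+1 -> R, activity lam /\ unique_gibbs nb h lam.
Proof.
move=> ctr hs bnb [D deg] [f0 f0h].
pose I := (n.+1 ^ (2 * D.+1 ^ N))%N.
(* [I] pays for the fibres of the fold and [D.+1] for the next site of a walk, both per site of the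
   path; the factor 2 leaves the decay 2^-M. The successor keeps [Lam] positive for D = 0. *)
pose Lam := (2 * D.+1 * I)%N.
have I0 : (0 < I)%N by rewrite expn_gt0.
have Lam0 : (0 < Lam)%N by rewrite !muln_gt0.
have lam0 := @rank_activity_gt0 R n rk Lam Lam0.
set lam := rank_activity rk Lam in lam0.
exists lam; split => //.
have [P [Pg _]] := gibbs_exists bnb hs lam0 f0h.
exists P; split => // Q Qg; apply: gibbs_eq => U a.
pose mu t M := mass (h := h) nb lam t (ball nb U (M + N)) (cylset U a) /
  pfun (h := h) nb lam (ball nb U (M + N)) t.
pose del M : R := (size U)%:R / (2 ^ M)%:R.
have close t t' M : is_hom nb h t -> is_hom nb h t' -> mu t M <= mu t' M + del M.
  move=> th t'h; set B := ball nb U (M + N).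
  have Z0 := pfun_gt0 lam0 B th; have Z0' := pfun_gt0 lam0 B t'h.
  have cmp := @mass_compare R n h V nb N x0 rk Lam bnb Lam0 B t t' U M (fun v => id) a.
  have per := @percolation_sum R n h V nb N rho x0 rk D Lam bnb ctr deg Lam0 B t t' U M (fun v => id).
  set S := \sum_(p | _) _ in cmp per.
  rewrite -(ler_pM2r (mulr_gt0 Z0 Z0')).
  have -> : mu t M * (pfun (h := h) nb lam B t * pfun (h := h) nb lam B t') =
      mass (h := h) nb lam t B (cylset U a) * pfun (h := h) nb lam B t'.
    by rewrite /mu -/B mulrA divfK ?lt0r_neq0.
  apply: le_trans cmp _.
  have -> : (mu t' M + del M) * (pfun (h := h) nb lam B t * pfun (h := h) nb lam B t') =
      pfun (h := h) nb lam B t * mass (h := h) nb lam t' B (cylset U a) +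
      del M * (pfun (h := h) nb lam B t * pfun (h := h) nb lam B t').
    by rewrite mulrDl; congr (_ + _); rewrite mulrCA /mu -/B divfK ?lt0r_neq0.
  rewrite lerD2l.
  set Z := pfun (h := h) nb lam B t * pfun (h := h) nb lam B t' in per *; have Zp : 0 < Z by exact: mulr_gt0.
  have LM0 : (0 < (Lam ^ M.+1)%:R :> R) by rewrite ltr0n expn_gt0 Lam0.
  rewrite -(ler_pM2l LM0); apply: le_trans per _.
  rewrite [leRHS]mulrA; apply: ler_wpM2r; first exact: ltW.
  rewrite /del mulrA ler_pdivlMr ?ltr0n ?expn_gt0 // -!natrM ler_nat -/I.
  rewrite /Lam !expnMn.
  have -> : (size U * D ^ M * I ^ M.+1 * 2 ^ M = 2 ^ M * D ^ M * I ^ M.+1 * size U)%N by lia.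
  rewrite leq_mul2r leq_mul2r; apply/orP; right; apply/orP; right.
  apply: leq_mul; first by rewrite leq_exp2l.
  apply: leq_trans (_ : D.+1 ^ M <= _)%N; last by rewrite leq_pexp2l.
  by case: (M) => // M'; rewrite leq_exp2r.
have band M (P' : probability (Omega V n) R) : gibbs nb h lam P' ->
    mu f0 M - del M <= pr P' (cylset U a) <= mu f0 M + del M.
  move=> P'g; apply: (gibbs_sandwich bnb hs lam0 P'g (B := ball nb U (M + N))).
    by move=> v vU; apply: (ball_leq (k := 0%N)).
  move=> t th; have Z0 := pfun_gt0 lam0 (ball nb U (M + N)) th.
  apply/andP; split.
    by rewrite -ler_pdivlMr // lerBlDr; exact: (close f0 t).
  by rewrite -ler_pdivrMr //; exact: (close t f0).
apply/eqP; rewrite -subr_eq0 -normr_eq0; apply/eqP.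
apply: (@eq0_geometric _ _ (2 * size U)) => // M.
rewrite -ler_pdivlMr ?ltr0n ?expn_gt0 // natrM -mulrA -/(del M).
have := band M P Pg; have := band M Q Qg; rewrite ler_norml; lra.
Qed.

Unset Implicit Arguments.

Theorem theorem8p1 (R : realType) (n : nat) (h : rel 'I_n.+1)
  (h_sym : symmetric h)
  (h_conn : forall x y : 'I_n.+1, connect h x y)
  (h_edge : exists x y : 'I_n.+1, h x y) :
  [<->
  (* (i) *) dismantlable h;
  (* (ii) *) cop_win h;
  (* (iii) *)
  (forall (V : finType) (nb : V -> seq V), board nb ->
     forall f g : V -> 'I_n.+1, is_hom nb h f -> is_hom nb h g -> hom_path nb h f g);
  (* (iv) *)
  (forall (V : countType) (nb : V -> seq V), board nb ->
     forall f g : V -> 'I_n.+1, is_hom nb h f -> is_hom nb h g ->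
     (exists s : seq V, forall v, v \notin s -> f v = g v) -> hom_path nb h f g);
  (* (v) *)
  (exists m : nat, (0 < m)%N /\
     forall (V : countType) (nb : V -> seq V), board nb ->
     forall (U W : set V), (forall u v, U u -> W v -> ~ dist_le nb m.-1 u v) ->
     forall f g : V -> 'I_n.+1, is_hom nb h f -> is_hom nb h g ->
     exists t : V -> 'I_n.+1, is_hom nb h t /\
       (forall u, U u -> t u = f u) /\ (forall v, W v -> t v = g v));
  (* (vi) *)
  (forall r : nat, (0 < r)%N ->
     forall f g : tword r -> 'I_n.+1, is_hom (@tnb r) h f -> is_hom (@tnb r) h g ->
     f <> g ->
     exists (u : tword r) (U : seq (tword r)) (t : tword r -> 'I_n.+1),
       f u <> g u /\ u \in U /\ is_hom (@tnb r) h t /\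
       (forall v, v \notin U -> t v = g v) /\ t u = f u);
  (* (vii) *)
  (forall (V : countType) (nb : V -> seq V), board nb ->
     forall lam : 'I_n.+1 -> R, activity lam ->
     forall P : probability (Omega V n) R,
       P (homset nb h) = 1%E -> one_site nb h lam P -> gibbs nb h lam P);
  (* (viii) *)
  (forall (V : finType) (nb : V -> seq V), board nb ->
     forall lam : 'I_n.+1 -> R, activity lam ->
     forall P : probability (Omega V n) R,
       stationary nb h lam P -> gibbs nb h lam P);
  (* (ix) *)
  (forall (V : countType) (nb : V -> seq V), board nb ->
     (exists D : nat, forall v, (size (undup (nb v)) <= D)%N) ->
     (exists f : V -> 'I_n.+1, is_hom nb h f) ->
     exists lam : 'I_n.+1 -> R, activity lam /\ unique_gibbs nb h lam);
  (* (x) *)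
  (forall r : nat, (0 < r)%N ->
     exists lam : 'I_n.+1 -> R, activity lam /\ unique_gibbs (@tnb r) h lam)
  ].
Proof.
have nbr := nbr_exists h_sym h_conn h_edge.
have paths : dismantlable h -> forall (V : countType) (nb : V -> seq V), board nb ->
    forall f g : V -> 'I_n.+1, is_hom nb h f -> is_hom nb h g ->
    (exists s : seq V, forall v, v \notin s -> f v = g v) -> hom_path nb h f g.
  move=> /(dismantlable_collapse h_sym) [N [rho [x0 [rk ctr]]]] V nb bnb f g.
  exact: (collapse_paths bnb ctr).
have conn : dismantlable h -> forall (V : finType) (nb : V -> seq V), board nb ->
    forall f g : V -> 'I_n.+1, is_hom nb h f -> is_hom nb h g -> hom_path nb h f g.
  move=> /paths hp V nb bnb f g fh gh; apply: hp => //.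
  by exists (enum V) => v; rewrite mem_enum.
(* Each implication passes through dismantlability, except (v) to (vi) and (ix) to (x), which are
   direct. *)
tfae.
- move=> /(dismantlable_collapse h_sym) [N [rho [x0 [rk ctr]]]].
  exact: collapse_cop_win nbr _ _ _ _ ctr.
- by move=> /(cop_win_dismantlable h_sym nbr)/conn.
- by move=> /(connected_homs_dismantlable h_sym h_edge)/paths.
- move=> hp; have : dismantlable h.
    apply: (connected_homs_dismantlable h_sym h_edge) => V nb bnb f g fh gh.
    by apply: hp => //; exists (enum V) => v; rewrite mem_enum.
  move=> /(dismantlable_collapse h_sym) [N [rho [x0 [rk ctr]]]].
  (* Distance at least m is the negation of distance at most [m.-1], which is here the [N.*2] of
     [collapse_mixing]. *)
  exists N.*2.+1; split=> // V nb bnb U W UW f g fh gh.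
  exact: (collapse_mixing bnb ctr h_sym UW fh gh).
- move=> [m [_ mix]] r _; exact: (mixing_tree_extension h_sym mix).
- move=> /(tree_extension_dismantlable h_sym nbr).
  move=> /(dismantlable_collapse h_sym) [N [rho [x0 [rk ctr]]]] V nb bnb lam lam0 P.
  exact: (one_site_gibbs bnb h_sym lam0 ctr).
- move=> /(one_site_dismantlable h_sym h_edge)/conn hp V nb bnb lam lam0 P st.
  exact: (stationary_gibbs bnb h_sym lam0 st.1 (hp V nb bnb) st).
- move=> /(stationary_dismantlable h_sym h_edge).
  move=> /(dismantlable_collapse h_sym) [N [rho [x0 [rk ctr]]]] V nb bnb.
  exact: (collapse_unique_gibbs R ctr h_sym bnb).
- move=> uniq r _; apply: uniq; first exact: tree_board.
    by exists r.+2 => v; exact: tnb_size.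
  exact: tree_hom h_edge h_sym.
- exact: (tree_unique_dismantlable h_sym nbr).
Qed.
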